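(* In the setting described in the context, fix $T>0$ and $x\in[0,1]$, and suppose assumptions (A1)–(A4) hold. Then, as $m,n\to\infty$ in such a way that $m/n\to0$: 1. If $x\in(0,1)$, $n^{1/2}m^{-1/4}\big[\hat f_{m,n}(x)-\mathbb E(\hat f_{m,n}(x))\big]$ converges in law to $\mathcal N(0,g(x)\psi(x))$, where $\psi(x)=(4\pi x(1-x))^{-1/2}$. 2. If $x\in\{0,1\}$, $n^{1/2}m^{-1/2}\big[\hat f_{m,n}(x)-\mathbb E(\hat f_{m,n}(x))\big]$ converges in law to $\mathcal N(0,g(x))$.
   Context: Let $H\in(\frac12,1)$. On a filtered probability space satisfying the usual conditions, let $W^{H,1},W^{H,2},\dots$ be independent normalized fractional Brownian motions with Hurst index $H$, and let $\phi_1,\phi_2,\dots$ be i.i.d. real random variables, independent of the fBms, with common density $f$ supported on $[0,1]$. For each $j$, $X^j$ solves $dX^j_t=(a(X^j_t)+\phi_j b(t))dt+\sigma(t)dW^{H,j}_t$, $X^j_0=x_0$, with $a,b$ known functions and $\sigma$ a known positive non-vanishing function; $X^j$ is observed continuously on $[0,T]$. Define $\kappa_H=2H\Gamma(\frac32-H)\Gamma(H+\frac12)$, $k_H(t,s)=\kappa_H^{-1}s^{\frac12-H}(t-s)^{\frac12-H}\mathbf 1_{(0,t)}(s)$, $\lambda_H=\frac{2H\Gamma(3-2H)\Gamma(H+\frac12)}{\Gamma(\frac32-H)}$, $w^H_t=\lambda_H^{-1}t^{2-2H}$, $J_1^j(t)=\frac{d}{dw^H_t}\int_0^t k_H(t,s)\frac{a(X^j_s)}{\sigma(s)}ds$,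 $J_2(t)=\frac{d}{dw^H_t}\int_0^t k_H(t,s)\frac{b(s)}{\sigma(s)}ds$, $Z^j_t=\int_0^t\frac{k_H(t,s)}{\sigma(s)}dX^j_s$, and $\hat\phi_{j,T}=\frac{\int_0^T J_2(t)dZ^j_t-\int_0^T J_1^j(t)J_2(t)dw^H_t}{\int_0^T J_2^2(t)dw^H_t}$. Let $p_k(m,x)=\binom{m}{k}x^k(1-x)^{m-k}$, $\hat F_n(y)=\frac1n\sum_{j=1}^n\mathbf 1_{\{\hat\phi_{j,T}\le y\}}$, and $\hat f_{m,n}(x)=m\sum_{k=0}^{m-1}\big[\hat F_n(\frac{k+1}{m})-\hat F_n(\frac km)\big]p_k(m-1,x)$. Assumptions: (A1) $\int_0^T J_2^2(t)dw^H_t<\infty$ a.s. for every $T>0$; (A2) $\lim_{T\to\infty}\int_0^T J_2^2(t)dw^H_t=\infty$ a.s.; (A3) $f$ is twice continuously differentiable on $[0,1]$; (A4) the random variable $\hat\phi_{1,T}$ has a positive density $g$ that is continuous at $x$, with distribution function $G$. *)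

(* Defs.v *)
From HB Require Import structures.
From mathcomp Require Import all_boot all_order all_algebra.
From mathcomp Require Import all_classical all_reals all_analysis.
Set Implicit Arguments. Unset Strict Implicit. Unset Printing Implicit Defensive.
Import Order.TTheory GRing.Theory Num.Theory.
Import numFieldNormedType.Exports.
Local Open Scope classical_set_scope.
Local Open Scope ring_scope.

Section defs.
Context {d : measure_display} {T : measurableType d} {R : realType}.

(* Mutual independence of the sequence (Y j)_j : product rule for every
   initial finite family (equivalent to the product rule over every finite
   subfamily, by taking B j = setT for unused indices). *)
Definition mutually_independent (P : probability T R) (Y : nat -> T -> R) :=
  forall (n : nat) (B : nat -> set R), (forall j, measurable (B j)) ->
    P [set w | forall j, (j < n)%N -> B j (Y j w)]
    = (\prod_(j < n) P (Y j @^-1` B j))%E.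

Definition ecdf (Y : nat -> T -> R) (n : nat) (w : T) (y : R) : R :=
  n%:R^-1 * \sum_(j < n) ((Y j w <= y)%R : bool)%:R.

Definition bern (k m : nat) (x : R) : R :=
  'C(m, k)%:R * x ^+ k * (1 - x) ^+ (m - k).

Definition fhat (Y : nat -> T -> R) (m n : nat) (x : R) (w : T) : R :=
  m%:R * \sum_(k < m) (ecdf Y n w (k.+1%:R / m%:R) - ecdf Y n w (k%:R / m%:R))
           * bern k (m - 1) x.

End defs.

Definition psi {R : realType} (x : R) : R :=
  (Num.sqrt (4 * pi * x * (1 - x)))^-1.

(* Main.v *)
Require Import Defs.
From HB Require Import structures.
From mathcomp Require Import all_boot all_order all_algebra.
From mathcomp Require Import all_classical all_reals all_analysis.
From mathcomp Require Import measurable_realfun.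
From mathcomp Require Import zify ring lra.
Import Order.TTheory GRing.Theory Num.Theory.
Import numFieldNormedType.Exports.
Local Open Scope classical_set_scope.
Local Open Scope ring_scope.

(** Up to centering and scaling, [fhat] at [x] is a sum of [n] independent copies
    of [m * p_K(m-1, x)], where [K] is the index of the cell [(k/m, (k+1)/m]]
    containing the observation.  As these variables are finitely valued, the law
    of the sum is an [n]-fold iterate of a finite averaging operator, and the
    triangular-array central limit theorem follows from Lindeberg's replacement
    argument in Trotter's operator form: the averaging operator is compared with
    the Gaussian one, which forms a semigroup, on functions with a third-order
    Taylor bound, and half-line indicators are sandwiched between cubic splines.

    The variance is governed by [sum_k p_k(m-1, x)^2].  By Parseval it equals
    [(2 pi)^-1] times the integral of [(1 - 2x(1-x)(1 - cos t))^(m-1)] over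
    [[-pi, pi]], and comparison with a Gaussian integral gives the equivalent
    [m^(-1/2) psi x].  Cells near [x] have mass close to [g x / m], and for the
    others [p_k = O(1/m)] by Chebyshev's inequality. *)

(** * Gaussian averaging *)

(** Independence is used only once, to identify the law of the sum with an iterated operator; from
    then on the argument compares operators on real functions, using only that they are contractions
    preserving a class of smooth functions. The obstacle is that [g] is controlled only near [x]: of
    the remaining cell masses nothing is known but that they sum to at most one. Far cells are
    therefore tamed through their weights. Since [m p_k = O(1)] there, they contribute [O(1)] to the
    first two moments of [m p_K], whereas the second moment grows like [m^(1/2)], or like [m] at the
    end points, so normalisation erases them. It erases the squared mean as well. The third moment
    needs no asymptotics of its own: [p_k <= (sum_k p_k^2)^(1/2)] bounds all scaled summands by a
    multiple of [(m/n)^(1/2)], which is where [m/n -> 0] enters. *)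

Lemma square_completion (R : realFieldType) (a b u r s D : R) :
  r != 0 -> s != 0 -> D != 0 -> D = r ^+ 2 + s ^+ 2 ->
  - (u - b) ^+ 2 / (s ^+ 2 * 2) + - (b - a) ^+ 2 / (r ^+ 2 * 2) =
  - (u - a) ^+ 2 / (D * 2) +
  - (b - (a * s ^+ 2 + u * r ^+ 2) / D) ^+ 2 / ((r ^+ 2 * s ^+ 2 / D) * 2).
Proof.
move=> r0 s0 D0 E.
have H : D * (2 * r ^+ 2 * s ^+ 2) != 0 by rewrite !mulf_neq0// ?expf_neq0// pnatr_eq0.
apply: (mulIf H).
transitivity (- (u - b) ^+ 2 * r^+2 * D - (b - a) ^+ 2 * s^+2 * D); first by field; rewrite r0 s0.
transitivity (- (u - a) ^+ 2 * r^+2 * s^+2 - (b * D - (a * s ^+ 2 + u * r ^+ 2)) ^+ 2);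
  last by field; rewrite r0 s0 D0.
by rewrite E; ring.
Qed.

Section gauss.
Context {R : realType}.
Implicit Types (a s r t u z : R) (h f : R -> R).
Local Notation mu := (@lebesgue_measure R).

Definition gauss_avg s h a : R := \int[mu]_u (h u * normal_pdf a s u).

Lemma normal_peakE s : 0 < s -> normal_peak s = (s * Num.sqrt (pi *+ 2))^-1.
Proof.
move=> s0; rewrite /normal_peak -mulrnAr sqrtrM ?sqr_ge0//.
by rewrite sqrtr_sqr gtr0_norm.
Qed.

Lemma sqrt2pi_gt0 : 0 < Num.sqrt (pi *+ 2) :> R.
Proof. by rewrite sqrtr_gt0 mulrn_wgt0// pi_gt0. Qed.

Lemma normal_pdfP a s u : 0 < s ->
  normal_pdf a s u = (s * Num.sqrt (pi *+ 2))^-1 * expR (- (u - a) ^+ 2 / (s ^+ 2 * 2)).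
Proof. by move=> s0; rewrite mulr_natr normal_pdfE ?gt_eqF// normal_peakE. Qed.

(** Completing the square in [b]: the last factor is the conditional density of the intermediate
    point given the end point [u], so integrating over [b] leaves only the convolved density. *)
Lemma normal_pdf_convol a r s u b : 0 < r -> 0 < s ->
  normal_pdf b s u * normal_pdf a r b =
  normal_pdf a (Num.sqrt (r ^+ 2 + s ^+ 2)) u *
  normal_pdf ((a * s ^+ 2 + u * r ^+ 2) / (r ^+ 2 + s ^+ 2))
    (r * s / Num.sqrt (r ^+ 2 + s ^+ 2)) b.
Proof.
move=> r0 s0.
have D0 : 0 < r ^+ 2 + s ^+ 2 by rewrite addr_gt0// exprn_gt0.
have S0 : 0 < Num.sqrt (r ^+ 2 + s ^+ 2) by rewrite sqrtr_gt0.
rewrite !normal_pdfP//; last by rewrite divr_gt0// mulr_gt0.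
have K0 := sqrt2pi_gt0.
rewrite mulrACA [RHS]mulrACA -!expRD; congr (_ * _).
  by field; rewrite !gt_eqF.
congr expR; rewrite !exprMn exprVn sqr_sqrtr; last exact: ltW.
by rewrite -square_completion ?gt_eqF.
Qed.

Lemma gauss_const_ge0 s : 0 < s -> 0 <= (s * Num.sqrt (pi *+ 2))^-1.
Proof. by move=> s0; rewrite invr_ge0 mulr_ge0// ltW. Qed.

Lemma measurable_normal_pdf2 s : 0 < s ->
  measurable_fun [set: R * R] (fun p : R * R => normal_pdf p.1 s p.2).
Proof.
move=> s0; under eq_fun do rewrite normal_pdfP//.
apply: measurable_funM => //; apply: measurableT_comp => //.
apply: measurable_funM => //; apply: measurableT_comp => //.
by apply: measurable_funX; apply: measurable_funB; 
  [exact: measurable_snd|exact: measurable_fst].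
Qed.

Lemma integrable_scale f (c : R) : mu.-integrable setT (fun u => (f u)%:E) ->
  mu.-integrable setT (fun u => (c * f u)%:E).
Proof.
move=> If; apply: eq_integrable (integrableZl _ c If) => //.
Qed.

(** Half-line indicators, their smoothings and all their averages stay in this class, where
    integrability against a normal density is automatic. *)
Definition unit_valued f := measurable_fun [set: R] f /\ forall u, 0 <= f u <= 1.

Lemma unit_valued_integrable f s a : unit_valued f ->
  mu.-integrable setT (fun u => (f u * normal_pdf a s u)%:E).
Proof.
move=> [mf f01]; apply: (le_integrable _ _ _ (integrable_normal_pdf a s)) => //.
  apply/measurable_EFinP; apply: measurable_funM => //; exact: measurable_normal_pdf.
move=> u _; rewrite /= lee_fin normrM !ger0_norm ?normal_pdf_ge0//.
  by rewrite ler_piMl ?normal_pdf_ge0//; case/andP: (f01 u).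
by case/andP: (f01 u).
Qed.

Lemma gauss_avg_EFin f s a : unit_valued f ->
  (gauss_avg s f a)%:E = (\int[mu]_u (f u * normal_pdf a s u)%:E)%E.
Proof.
move=> hf; rewrite /gauss_avg /Rintegral fineK// integrable_fin_num//.
exact: unit_valued_integrable.
Qed.

Lemma Rintegral_normal_pdf a s : \int[mu]_u normal_pdf a s u = 1.
Proof. by rewrite /Rintegral integral_normal_pdf. Qed.

Lemma gauss_avg_dist f h s a e : unit_valued f -> unit_valued h ->
  (forall u, `|f u - h u| <= e) -> `|gauss_avg s f a - gauss_avg s h a| <= e.
Proof.
move=> hf hh fh.
have If := @unit_valued_integrable f s a hf; have Ih := @unit_valued_integrable h s a hh.
have Ie : mu.-integrable setT (fun u => (e * normal_pdf a s u)%:E).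
  apply: integrable_scale; exact: integrable_normal_pdf.
rewrite /gauss_avg -RintegralB//.
apply: le_trans (le_normr_Rintegral _ _) _ => //.
  by apply: eq_integrable (integrableB _ If Ih).
rewrite -[leRHS]mulr1 -(Rintegral_normal_pdf a s) -RintegralZl//; last exact: integrable_normal_pdf.
apply: le_Rintegral => //.
  apply: (@integrable_norm _ _ _ mu _ (fun u => f u * normal_pdf a s u - h u * normal_pdf a s u)).
  by apply: eq_integrable (integrableB _ If Ih).
by move=> u _; rewrite -mulrBl normrM (ger0_norm (normal_pdf_ge0 _ _ _)) ler_wpM2r ?normal_pdf_ge0.
Qed.

Lemma gauss_avg_unit_valued f s : 0 < s -> unit_valued f -> unit_valued (gauss_avg s f).
Proof.
move=> s0 hf; have [mf f01] := hf; split.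
  apply/measurable_EFinP.
  rewrite (_ : _ \o _ = fun a => (\int[mu]_u (f u * normal_pdf a s u)%:E)%E); last first.
    by apply/funext => a /=; rewrite gauss_avg_EFin.
  apply: (@measurable_fun_fubini_tonelli_F _ _ _ _ _ mu
    (fun p : R * R => (f p.2 * normal_pdf p.1 s p.2)%:E)) => //.
    apply/measurable_EFinP; apply: measurable_funM; last exact: measurable_normal_pdf2.
    by apply: measurableT_comp => //; exact: measurable_snd.
  by move=> p; rewrite lee_fin mulr_ge0// ?normal_pdf_ge0//; case/andP: (f01 p.2).
move=> a; apply/andP; split.
  apply: Rintegral_ge0 => u _; rewrite mulr_ge0// ?normal_pdf_ge0//.
  by case/andP: (f01 u).
rewrite -(Rintegral_normal_pdf a s); apply: le_Rintegral => //.
- exact: unit_valued_integrable.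
- exact: integrable_normal_pdf.
by move=> u _; rewrite ler_piMl ?normal_pdf_ge0//; case/andP: (f01 u).
Qed.

(** This is the heat semigroup indexed by standard deviation, whence the sum of squares. After
    Tonelli the intermediate point integrates to 1 by [normal_pdf_convol]. *)
Lemma gauss_avg_semigroup f r s a : 0 < r -> 0 < s -> unit_valued f ->
  gauss_avg r (gauss_avg s f) a = gauss_avg (Num.sqrt (r ^+ 2 + s ^+ 2)) f a.
Proof.
move=> r0 s0 hf; have [mf f01] := hf.
have pf u : 0 <= f u by case/andP: (f01 u).
apply: EFin_inj; rewrite (gauss_avg_EFin (gauss_avg s f)); last exact: gauss_avg_unit_valued.
rewrite (gauss_avg_EFin f _ _ hf).
transitivity (\int[mu]_b \int[mu]_u (f u * normal_pdf b s u * normal_pdf a r b)%:E)%E.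
  apply: eq_integral => b _; rewrite EFinM gauss_avg_EFin// -ge0_integralZr//.
  - apply/measurable_EFinP; apply: measurable_funM => //; exact: measurable_normal_pdf.
  - by move=> u _; rewrite lee_fin mulr_ge0// normal_pdf_ge0.
  - by rewrite lee_fin normal_pdf_ge0.
have := @fubini_tonelli _ _ _ _ _ mu mu
   (fun p : R * R => (f p.2 * normal_pdf p.1 s p.2 * normal_pdf a r p.1)%:E).
rewrite /fubini_F /fubini_G /= => ->; last 2 first.
  apply/measurable_EFinP; apply: measurable_funM; first apply: measurable_funM.
  - by apply: measurableT_comp => //; exact: measurable_snd.
  - exact: measurable_normal_pdf2.
  - by apply: (measurableT_comp (measurable_normal_pdf a r)); exact: measurable_fst.
  by move=> p; rewrite lee_fin !mulr_ge0// ?normal_pdf_ge0.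
apply: eq_integral => u _.
under eq_integral => b _ do rewrite -mulrA normal_pdf_convol// mulrA EFinM.
rewrite ge0_integralZl//.
- by rewrite integral_normal_pdf mule1.
- by apply/measurable_EFinP; exact: measurable_normal_pdf.
- by move=> b _; rewrite lee_fin normal_pdf_ge0.
- by rewrite lee_fin mulr_ge0// normal_pdf_ge0.
Qed.


Lemma quartic_expR_le z : (1 + z ^+ 2) ^+ 2 * expR (- z ^+ 2 / 2) <=
  32 * expR (- (z / 2) ^+ 2 / 2).
Proof.
have -> : - z ^+ 2 / 2 = - (3 / 8 * z ^+ 2) + - (z / 2) ^+ 2 / 2 by field.
rewrite expRD mulrA ler_wpM2r ?expR_ge0// expRN ler_pdivrMr ?expR_gt0//.
(* Splitting the exponent in two gives a square of a linear lower bound, hence growth of order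
   [z^4]; the factor 32 suffices because [32 * (3/16)^2 >= 1]. *)
have -> : 3 / 8 * z ^+ 2 = 3 / 16 * z ^+ 2 + 3 / 16 * z ^+ 2 by field.
rewrite expRD; have := expR_ge1Dx (3 / 16 * z ^+ 2).
have := sqr_ge0 z; move: (z ^+ 2) (expR _) => y e y0 ye.
by have : (1 + 3 / 16 * y) * (1 + 3 / 16 * y) <= e * e; [apply: ler_pM; lra | nra].
Qed.

(* Doubling the standard deviation absorbs quartic growth, so all moments up to the
   fourth are bounded without computing them. *)
Lemma quartic_normal_pdf_le a s u : 0 < s ->
  (1 + ((u - a) / s) ^+ 2) ^+ 2 * normal_pdf a s u <= 64 * normal_pdf a (2 * s) u.
Proof.
move=> s0; rewrite !normal_pdfP//; last by rewrite mulr_gt0.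
have K0 := sqrt2pi_gt0.
have := quartic_expR_le ((u - a) / s).
have -> : - ((u - a) / s) ^+ 2 / 2 = - (u - a) ^+ 2 / (s ^+ 2 * 2).
  by field; rewrite gt_eqF.
have -> : - ((u - a) / s / 2) ^+ 2 / 2 = - (u - a) ^+ 2 / ((2 * s) ^+ 2 * 2).
  by field; rewrite gt_eqF.
move=> H; rewrite mulrCA.
have -> : 64 * ((2 * s * Num.sqrt (pi *+ 2))^-1 * expR (- (u - a) ^+ 2 / ((2 * s) ^+ 2 * 2)))
  = (s * Num.sqrt (pi *+ 2))^-1 * (32 * expR (- (u - a) ^+ 2 / ((2 * s) ^+ 2 * 2))).
  by field; rewrite !gt_eqF.
by rewrite (ler_wpM2l (gauss_const_ge0 _ s0)).
Qed.

Lemma gauss_avg_integrable f a s B : 0 < s -> measurable_fun setT f ->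
  (forall u, `|f u| <= B * (1 + ((u - a) / s) ^+ 2) ^+ 2) ->
  mu.-integrable setT (fun u => (f u * normal_pdf a s u)%:E).
Proof.
move=> s0 mf fB.
have I2 : mu.-integrable setT (fun u => (B * 64 * normal_pdf a (2 * s) u)%:E).
  apply: integrable_scale; exact: integrable_normal_pdf.
apply: (le_integrable _ _ _ I2) => //.
  apply/measurable_EFinP; apply: measurable_funM => //; exact: measurable_normal_pdf.
move=> u _; rewrite /= lee_fin normrM (ger0_norm (normal_pdf_ge0 _ _ _)).
have B0 : 0 <= B.
  have := le_trans (normr_ge0 _) (fB u); rewrite pmulr_lge0// exprn_gt0//.
  by rewrite ltr_pwDl// sqr_ge0.
apply: le_trans (ler_norm _); apply: le_trans (ler_wpM2r _ (fB u)) _; first exact: normal_pdf_ge0.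
by rewrite -[leLHS]mulrA -[leRHS]mulrA ler_wpM2l// quartic_normal_pdf_le.
Qed.

Lemma gauss_avg_bound f a s B : 0 < s -> measurable_fun setT f ->
  (forall u, `|f u| <= B * (1 + ((u - a) / s) ^+ 2) ^+ 2) ->
  `|gauss_avg s f a| <= 64 * B.
Proof.
move=> s0 mf fB; have If := gauss_avg_integrable _ _ _ _ s0 mf fB.
rewrite /gauss_avg; apply: le_trans (le_normr_Rintegral _ If) _ => //.
have I2 : mu.-integrable setT (fun u => (64 * B * normal_pdf a (2 * s) u)%:E).
  apply: integrable_scale; exact: integrable_normal_pdf.
have <- : \int[mu]_u (64 * B * normal_pdf a (2 * s) u) = 64 * B.
  by rewrite RintegralZl ?Rintegral_normal_pdf ?mulr1//; exact: integrable_normal_pdf.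
apply: le_Rintegral => //.
  by apply: (@integrable_norm _ _ _ mu _ (fun u => f u * normal_pdf a s u)).
move=> u _; rewrite normrM (ger0_norm (normal_pdf_ge0 _ _ _)).
have B0 : 0 <= B.
  have := le_trans (normr_ge0 _) (fB u); rewrite pmulr_lge0// exprn_gt0//.
  by rewrite ltr_pwDl// sqr_ge0.
apply: le_trans (ler_wpM2r _ (fB u)) _; first exact: normal_pdf_ge0.
by rewrite (mulrC 64) -[leLHS]mulrA -[leRHS]mulrA ler_wpM2l// quartic_normal_pdf_le.
Qed.

Lemma gauss_avg_affine f a s (c0 c1 : R) : 
  mu.-integrable setT (fun u => (f u * normal_pdf a s u)%:E) ->
  \int[mu]_u ((c0 + c1 * f u) * normal_pdf a s u) = c0 + c1 * gauss_avg s f a.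
Proof.
move=> If.
have I0 : mu.-integrable setT (fun u => (c0 * normal_pdf a s u)%:E).
  apply: integrable_scale; exact: integrable_normal_pdf.
have I1 : mu.-integrable setT (fun u => (c1 * (f u * normal_pdf a s u))%:E).
  exact: integrable_scale.
under eq_Rintegral do rewrite mulrDl -mulrA.
rewrite RintegralD// !RintegralZl//; last exact: integrable_normal_pdf.
by rewrite Rintegral_normal_pdf mulr1.
Qed.

Lemma affine_integrable f a s (c0 c1 : R) : 
  mu.-integrable setT (fun u => (f u * normal_pdf a s u)%:E) ->
  mu.-integrable setT (fun u => ((c0 + c1 * f u) * normal_pdf a s u)%:E).
Proof.
move=> If.
have I0 : mu.-integrable setT (fun u => (c0 * normal_pdf a s u)%:E).
  apply: integrable_scale; exact: integrable_normal_pdf.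
have I1 : mu.-integrable setT (fun u => (c1 * (f u * normal_pdf a s u))%:E).
  exact: integrable_scale.
apply: eq_integrable (integrableD _ I0 I1) => // u _.
by rewrite /= -EFinD mulrDl -mulrA.
Qed.

Lemma quartic_ge1 z : 1 <= (1 + z ^+ 2) ^+ 2.
Proof. by rewrite -[leLHS](expr1n _ 2) lerXn2r ?nnegrE//; have := sqr_ge0 z; lra. Qed.

Lemma pow_le_quartic z k : (k <= 4)%N -> `|z| ^+ k <= (1 + z ^+ 2) ^+ 2.
Proof.
move=> k4; rewrite -[z ^+ 2]real_normK ?num_real//; have := normr_ge0 z; move: `|z| => y y0.
have [y1|y1] := leP y 1.
  apply: (@le_trans _ _ 1); first by rewrite exprn_ile1.
  exact: quartic_ge1.
apply: (@le_trans _ _ (y ^+ 4)); first by rewrite ler_weXn2l// ltW.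
have -> : y ^+ 4 = (y ^+ 2) ^+ 2 by rewrite -exprM.
by rewrite lerXn2r ?nnegrE ?sqr_ge0// ?addr_ge0 ?sqr_ge0// lerDr.
Qed.

Lemma dev_le_quartic a s u k : 0 < s -> (k <= 4)%N ->
  `|u - a| ^+ k <= s ^+ k * (1 + ((u - a) / s) ^+ 2) ^+ 2.
Proof.
move=> s0 k4; have := pow_le_quartic ((u - a) / s) k k4.
rewrite normrM normfV (gtr0_norm s0) exprMn exprVn ler_pdivrMr ?exprn_gt0//.
by rewrite mulrC.
Qed.

Lemma measurable_dev a k : measurable_fun setT (fun u : R => (u - a) ^+ k).
Proof. by apply: measurable_funX; exact: measurable_funB. Qed.

Lemma dev_integrable a s k : 0 < s -> (k <= 4)%N ->
  mu.-integrable setT (fun u => ((u - a) ^+ k * normal_pdf a s u)%:E).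
Proof.
move=> s0 k4; apply: (@gauss_avg_integrable _ a s (s ^+ k)) => //.
  exact: measurable_dev.
by move=> u; rewrite normrX dev_le_quartic.
Qed.

(* [normal_pdf (a + t) s] is at least [1 + t (u - a) / s^2 - t^2 / (2 s^2)] times
   [normal_pdf a s]; integrating, [t * mean <= t^2 / 2] for every [t]. *)
Lemma gauss_avg_mean a s : 0 < s -> gauss_avg s (fun u => (u - a) ^+ 1) a = 0.
Proof.
move=> s0; set m := gauss_avg _ _ _.
have I1 := dev_integrable a s 1 s0 isT.
suff H t : t * m <= t ^+ 2 / 2.
  (* With [t = m] the inequality reads [m^2 <= m^2 / 2], which forces [m = 0]. *)
  by have := H m; rewrite expr2 => Hm; apply/eqP; rewrite -sqrf_eq0 expr2; apply/eqP; nra.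
have : \int[mu]_u ((1 - t ^+ 2 / (2 * s ^+ 2) + (t / s ^+ 2) * (u - a) ^+ 1) * normal_pdf a s u) <=
   \int[mu]_u normal_pdf (a + t) s u.
  apply: le_Rintegral => //; [exact: affine_integrable|exact: integrable_normal_pdf|].
  move=> u _; rewrite !normal_pdfP// mulrCA (ler_wpM2l (gauss_const_ge0 _ s0))//.
  set w := (X in X * _ <= _).
  have -> : - (u - (a + t)) ^+ 2 / (s ^+ 2 * 2) = (w - 1) + - (u - a) ^+ 2 / (s ^+ 2 * 2).
    by rewrite /w; field; rewrite gt_eqF.
  rewrite expRD ler_wpM2r ?expR_ge0//.
  by have := expR_ge1Dx (w - 1); rewrite addrC subrK.
rewrite gauss_avg_affine// -/m Rintegral_normal_pdf.
have s2 : 0 < s ^+ 2 by rewrite exprn_gt0.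
have -> : 1 - t ^+ 2 / (2 * s ^+ 2) + t / s ^+ 2 * m = 1 + (t * m - t ^+ 2 / 2) / s ^+ 2.
  by field; rewrite gt_eqF.
by rewrite gerDl pmulr_lle0 ?invr_gt0// subr_le0.
Qed.

(* Same device with the standard deviation moved from [s] to [r] on either side of
   [s]; the offset [e] below is a convenient choice of [r = s (1 + e)]. *)
Lemma gauss_avg_var a s : 0 < s -> gauss_avg s (fun u => (u - a) ^+ 2) a = s ^+ 2.
Proof.
move=> s0; set v := gauss_avg _ _ _.
have s2 : 0 < s ^+ 2 by rewrite exprn_gt0.
have I2 := dev_integrable a s 2 s0 isT.
have v64 : v <= 64 * s ^+ 2.
  apply: le_trans (ler_norm _) _; apply: gauss_avg_bound => //; first exact: measurable_dev.
  by move=> u; rewrite normrX dev_le_quartic.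
have v0 : 0 <= v.
  by apply: Rintegral_ge0 => u _; rewrite mulr_ge0 ?sqr_ge0 ?normal_pdf_ge0.
have H r : 0 < r -> (s / r) * (1 + (s ^- 2 - r ^- 2) / 2 * v) <= 1.
  move=> r0; rewrite mulrDr mulr1 [X in _ + X]mulrA.
  rewrite -gauss_avg_affine// -[leRHS](Rintegral_normal_pdf a r).
  apply: le_Rintegral => //; [exact: affine_integrable|exact: integrable_normal_pdf|].
  move=> u _; rewrite !normal_pdfP//.
  set w := (s ^- 2 - r ^- 2) / 2 * (u - a) ^+ 2.
  have -> : s / r + s / r * ((s ^- 2 - r ^- 2) / 2) * (u - a) ^+ 2 = s / r * (1 + w).
    by rewrite /w; ring.
  have K0 := sqrt2pi_gt0.
  have -> : (r * Num.sqrt (pi *+ 2))^-1 = (s / r) * (s * Num.sqrt (pi *+ 2))^-1 :> R.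
    by field; rewrite !gt_eqF.
  have sr0 : 0 <= s / r by rewrite divr_ge0// ltW.
  rewrite -[leLHS]mulrA -[leRHS]mulrA; apply: (ler_wpM2l sr0).
  rewrite mulrCA (ler_wpM2l (gauss_const_ge0 _ s0))//.
  have -> : - (u - a) ^+ 2 / (r ^+ 2 * 2) = w + - (u - a) ^+ 2 / (s ^+ 2 * 2).
    by rewrite /w; field; rewrite !gt_eqF.
  by rewrite expRD ler_wpM2r ?expR_ge0// expR_ge1Dx.
pose w := v / s ^+ 2.
have w64 : w <= 64 by rewrite ler_pdivrMr.
have w0 : 0 <= w by rewrite divr_ge0// ltW.
suff : w = 1 by move/(congr1 (fun x => x * s ^+ 2)); rewrite mul1r divfK// gt_eqF.
(* The offset has the sign of [w - 1], so the first-order term of the inequality is a positive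
   multiple of [(w - 1)^2]. With [0 <= w <= 64], the divisor 100 keeps [1 + e] positive and the
   higher-order corrections too small to change that sign. *)
pose e := (w - 1) / 100.
have e1 : 0 < 1 + e by rewrite /e; lra.
have := H (s * (1 + e)) (mulr_gt0 s0 e1).
have -> : s / (s * (1 + e)) * (1 + (s ^- 2 - (s * (1 + e)) ^- 2) / 2 * v) =
   (1 + (1 - (1 + e) ^- 2) / 2 * w) / (1 + e).
  by rewrite /w; field; rewrite !gt_eqF.
rewrite ler_pdivrMr// mul1r lerD2l.
have -> : (1 - (1 + e) ^- 2) / 2 * w =
    (e * (2 + e) * w / 2) / (1 + e) ^+ 2 by field; rewrite gt_eqF.
rewrite ler_pdivrMr ?exprn_gt0// => {}H.
have : (w - 1) ^+ 2 * (2 - (4 - w) / 100 - 2 * (w - 1) / 10000) <= 0.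
  have -> : (w - 1) ^+ 2 * (2 - (4 - w) / 100 - 2 * (w - 1) / 10000) =
     200 * (e * (2 + e) * w / 2 - e * (1 + e) ^+ 2) by rewrite /e; field.
  by rewrite pmulr_rle0// subr_le0.
rewrite pmulr_lle0; last lra.
move=> h; apply/eqP; rewrite -subr_eq0 -sqrf_eq0; apply/eqP/le_anti.
by rewrite h sqr_ge0.
Qed.

End gauss.

(** * Lindeberg's replacement argument *)

Section lindeberg.
Context {R : realType}.
Implicit Types (a s u K : R) (f : R -> R).
Local Notation mu := (@lebesgue_measure R).

(** [h1] and [h2] play the role of the first two derivatives; stating the expansion instead of
    differentiability makes it pass to averages at once. Only [h2] is bounded, since [h1] multiplies
    the mean of centred laws. *)
Definition taylor3 K f := exists h1 h2 : R -> R, (forall a, `|h2 a| <= K) /\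
  forall u a, `|f u - (f a + h1 a * (u - a) + h2 a / 2 * (u - a) ^+ 2)| <= K * `|u - a| ^+ 3.

(* Averaging over a finite law: the [i]-th shift [x i] has probability [q i]. *)
Definition avgshift (I : finType) (q x : I -> R) f a := \sum_i q i * f (a + x i).

(** The quadratic polynomial is averaged exactly through the first two Gaussian moments. The cubic
    remainder lies below [K * s^3] times the quartic envelope, so [gauss_avg_bound] supplies the
    64. *)
Lemma gauss_avg_taylor K f s a b c : 0 < s -> unit_valued f ->
  (forall u, `|f u - (f a + b * (u - a) + c / 2 * (u - a) ^+ 2)| <= K * `|u - a| ^+ 3) ->
  `|gauss_avg s f a - (f a + c / 2 * s ^+ 2)| <= 64 * (K * s ^+ 3).
Proof.
move=> s0 hf fP; have [mf f01] := hf.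
have K0 : 0 <= K.
  have := le_trans (normr_ge0 _) (fP (a + 1)).
  by rewrite addrC addKr normr1 expr1n mulr1.
pose Q u := b * (u - a) ^+ 1 + c / 2 * (u - a) ^+ 2.
pose P u := f a + Q u.
have I1 := dev_integrable a s 1 s0 isT.
have I2 := dev_integrable a s 2 s0 isT.
have IQ : mu.-integrable setT
    (fun u => (Q u * normal_pdf a s u)%:E).
  have := integrableD _ (integrable_scale _ b I1) (integrable_scale _ (c / 2) I2).
  move=> /(_ measurableT) /eq_integrable; apply => // u _.
  by rewrite /= -EFinD /Q; congr EFin; ring.
have gQ : gauss_avg s Q a = c / 2 * s ^+ 2.
  transitivity (\int[mu]_u (b * ((u - a) ^+ 1 * normal_pdf a s u) +
      c / 2 * ((u - a) ^+ 2 * normal_pdf a s u))).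
    by apply: eq_Rintegral => u _; rewrite /Q; ring.
  rewrite RintegralD//; [|exact: (integrable_scale (fun u => (u - a) ^+ 1 * normal_pdf a s u))
    |exact: (integrable_scale (fun u => (u - a) ^+ 2 * normal_pdf a s u))].
  rewrite !RintegralZl//.
  by rewrite -/(gauss_avg s (fun u => (u - a) ^+ 1) a) -/(gauss_avg s (fun u => (u - a) ^+ 2) a)
    gauss_avg_mean// gauss_avg_var// mulr0 add0r.
have IP : mu.-integrable setT (fun u => (P u * normal_pdf a s u)%:E).
  have := affine_integrable Q a s (f a) 1 IQ.
  by apply: eq_integrable => // u _; rewrite mul1r.
have gP : gauss_avg s P a = f a + c / 2 * s ^+ 2.
  rewrite -gQ -[gauss_avg s Q a]mul1r -gauss_avg_affine//.
  by apply: eq_Rintegral => u _; rewrite mul1r.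
have If := unit_valued_integrable f s a hf.
rewrite -gP -RintegralB//.
have -> : \int[mu]_u (f u * normal_pdf a s u - P u * normal_pdf a s u) =
    gauss_avg s (fun u => f u - P u) a by apply: eq_Rintegral => u _; rewrite mulrBl.
apply: gauss_avg_bound => //.
  apply: measurable_funB => //; apply: measurable_funD => //.
  by apply: measurable_funD; apply: measurable_funM => //; exact: measurable_dev.
move=> u; rewrite /P /Q addrA expr1; apply: le_trans (fP u) _.
by rewrite -mulrA ler_wpM2l// dev_le_quartic.
Qed.

Section step.
Context (I : finType) (q x : I -> R).
Hypotheses (q0 : forall i, 0 <= q i) (q1 : \sum_i q i = 1) (qx : \sum_i q i * x i = 0).

Lemma avg_cst (c : R) : c = \sum_i q i * c.
Proof. by rewrite -mulr_suml q1 mul1r. Qed.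

Lemma avgshift_unit_valued f : unit_valued f -> unit_valued (avgshift I q x f).
Proof.
move=> [mf f01]; split.
  apply: measurable_sum => i; apply: measurable_funM => //.
  by apply: measurableT_comp => //; exact: measurable_funD.
move=> a; apply/andP; split.
  by apply: sumr_ge0 => i _; rewrite mulr_ge0//; case/andP: (f01 (a + x i)).
rewrite -q1; apply: ler_sum => i _; rewrite ler_piMr//.
by case/andP: (f01 (a + x i)).
Qed.

(** The constant [K] does not deteriorate, so [n] replacements cost no more than [n] times one of
    them. *)
Lemma avgshift_taylor K f : taylor3 K f -> taylor3 K (avgshift I q x f).
Proof.
move=> [h1 [h2 [h2K fP]]].
exists (avgshift I q x h1), (avgshift I q x h2); split=> [a|u a].
  apply: le_trans (ler_norm_sum _ _ _) _.
  rewrite [leRHS]avg_cst; apply: ler_sum => i _.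
  by rewrite normrM ger0_norm// ler_wpM2l.
have -> : avgshift I q x f u - (avgshift I q x f a + avgshift I q x h1 a * (u - a) +
    avgshift I q x h2 a / 2 * (u - a) ^+ 2) =
  \sum_i q i * (f (u + x i) - (f (a + x i) + h1 (a + x i) * ((u + x i) - (a + x i)) +
    h2 (a + x i) / 2 * ((u + x i) - (a + x i)) ^+ 2)).
  rewrite /avgshift !mulr_suml -!big_split -sumrB; apply: eq_bigr => i _ /=.
  by ring.
apply: le_trans (ler_norm_sum _ _ _) _.
rewrite [leRHS]avg_cst; apply: ler_sum => i _.
rewrite normrM ger0_norm// ler_wpM2l//.
have -> : u - a = (u + x i) - (a + x i) by rewrite opprD addrACA subrr addr0.
exact: fP.
Qed.

(** The linear terms cancel, both laws being centred. What remains is the variance mismatch, halved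
    by the Taylor coefficient, and the two cubic remainders. *)
Definition one_step_error s :=
  `|\sum_i q i * x i ^+ 2 - s ^+ 2| / 2 + \sum_i q i * `|x i| ^+ 3 + 64 * s ^+ 3.

Lemma one_step K f s a : 0 < s -> unit_valued f -> taylor3 K f ->
  `|avgshift I q x f a - gauss_avg s f a| <= K * one_step_error s.
Proof.
move=> s0 hf [h1 [h2 [h2K fP]]].
have K0 : 0 <= K := le_trans (normr_ge0 _) (h2K 0).
have G := gauss_avg_taylor K f s a (h1 a) (h2 a) s0 hf (fP^~ a).
have A : `|avgshift I q x f a - (f a + h2 a / 2 * \sum_i q i * x i ^+ 2)| <=
    K * \sum_i q i * `|x i| ^+ 3.
  have -> : f a + h2 a / 2 * \sum_i q i * x i ^+ 2 =
      \sum_i q i * (f a + h1 a * ((a + x i) - a) + h2 a / 2 * ((a + x i) - a) ^+ 2).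
    rewrite [f a in LHS]avg_cst.
    transitivity (\sum_i q i * f a + h1 a * (\sum_i q i * x i) + h2 a / 2 * \sum_i q i * x i ^+ 2).
      by rewrite qx mulr0 addr0.
    rewrite !mulr_sumr -!big_split; apply: eq_bigr => i _ /=.
    by rewrite (addrC a) addrK; ring.
  rewrite /avgshift -sumrB; under eq_bigr do rewrite -mulrBr.
  apply: le_trans (ler_norm_sum _ _ _) _; rewrite mulr_sumr; apply: ler_sum => i _.
  rewrite normrM ger0_norm// [leRHS]mulrCA ler_wpM2l//.
  have := fP (a + x i) a; rewrite [X in K * `|X| ^+ 3](_ : _ = x i)//.
  by rewrite addrC addKr.
have B : `|(f a + h2 a / 2 * \sum_i q i * x i ^+ 2) - (f a + h2 a / 2 * s ^+ 2)| <=
    K * (`|\sum_i q i * x i ^+ 2 - s ^+ 2| / 2).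
  rewrite opprD addrACA subrr add0r -mulrBr normrM normrM [`|2^-1|]gtr0_norm ?invr_gt0//.
  by rewrite -mulrA (mulrC 2^-1) ler_wpM2r// mulr_ge0// invr_ge0.
have -> : K * one_step_error s = K * (\sum_i q i * `|x i| ^+ 3)
   + K * (`|\sum_i q i * x i ^+ 2 - s ^+ 2| / 2) + 64 * (K * s ^+ 3).
  by rewrite /one_step_error; ring.
rewrite distrC in G.
apply: le_trans (ler_distD (f a + h2 a / 2 * \sum_i q i * x i ^+ 2) _ _) _.
rewrite -[leRHS]addrA; apply: (lerD A).
apply: le_trans (ler_distD (f a + h2 a / 2 * s ^+ 2) _ _) _.
exact: (lerD B G).
Qed.

(** Telescoping. The induction hypothesis is applied to [avgshift I q x f], and the last replacement
    is made under a Gaussian average, where contraction is enough; thus [taylor3] has to be stable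
    under [avgshift] only. *)
Lemma lindeberg K f s n a : 0 < s -> unit_valued f -> taylor3 K f ->
  `|iter n.+1 (avgshift I q x) f a - gauss_avg (s * Num.sqrt n.+1%:R) f a|
  <= n.+1%:R * (K * one_step_error s).
Proof.
move=> s0; elim: n f a => [|n IH] f a hf hT.
  by rewrite sqrtr1 mulr1 mul1r; exact: one_step.
rewrite iterSr -natr1 mulrDl mul1r.
have hs : 0 < s * Num.sqrt n.+1%:R by rewrite mulr_gt0// sqrtr_gt0.
have -> : s * Num.sqrt (n.+1%:R + 1) = Num.sqrt ((s * Num.sqrt n.+1%:R) ^+ 2 + s ^+ 2).
  transitivity (Num.sqrt (s ^+ 2 * (n.+1%:R + 1))).
    by rewrite sqrtrM ?sqr_ge0// sqrtr_sqr gtr0_norm.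
  by rewrite exprMn sqr_sqrtr// mulrDr mulr1.
rewrite -gauss_avg_semigroup//.
apply: le_trans (ler_distD (gauss_avg (s * Num.sqrt n.+1%:R) (avgshift I q x f) a) _ _) _.
apply: lerD; first by apply: IH; [exact: avgshift_unit_valued|exact: avgshift_taylor].
apply: gauss_avg_dist; [exact: avgshift_unit_valued|exact: gauss_avg_unit_valued|].
by move=> u; exact: one_step.
Qed.

End step.
End lindeberg.

(** * Smoothed half-line indicators from cubic splines *)

Section spline.
Context {R : realType}.
Implicit Types (a s u y K : R) (f : R -> R).

(* The third difference of the truncated cubic is a smoothed unit step on [0, 3]. *)
Let c3 y : R := Num.max 0 y ^+ 3 / 6.

(** The second derivative of [c3] is [max 0], which is 1-Lipschitz; this explains the constant 1/6.
    The case split on signs proves it without differentiating. *)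
Let c3_taylor u a : `|c3 u - (c3 a + Num.max 0 a ^+ 2 / 2 * (u - a) +
  Num.max 0 a / 2 * (u - a) ^+ 2)| <= 6^-1 * `|u - a| ^+ 3.
Proof.
rewrite /c3; have [u0|u0] := leP 0 u; have [a0|a0] := leP 0 a.
- have -> : u ^+ 3 / 6 - (a ^+ 3 / 6 + a ^+ 2 / 2 * (u - a) + a / 2 * (u - a) ^+ 2)
    = 6^-1 * (u - a) ^+ 3 by field.
  by rewrite normrM normrX [`|6^-1|]gtr0_norm// invr_gt0.
- rewrite ger0_norm; last by rewrite !expr0n/= !mul0r !addr0 subr0 divr_ge0// exprn_ge0.
  rewrite ger0_norm; last lra.
  rewrite !expr0n/= !mul0r !addr0 subr0 mulrC ler_wpM2l ?invr_ge0//.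
  by rewrite lerXn2r ?nnegrE//; lra.
- have -> : `|u - a| = a - u by rewrite distrC gtr0_norm; lra.
  have -> : 0 ^+ 3 / 6 - (a ^+ 3 / 6 + a ^+ 2 / 2 * (u - a) + a / 2 * (u - a) ^+ 2) =
      - (6^-1 * ((a - u) ^+ 3 - (- u) ^+ 3)) by field.
  have v0 : 0 <= - u by lra.
  have uv : (- u) ^+ 3 <= (a - u) ^+ 3 by rewrite lerXn2r ?nnegrE//; lra.
  rewrite normrN ger0_norm ?mulr_ge0 ?subr_ge0 ?invr_ge0// ler_wpM2l ?invr_ge0//.
  by rewrite gerBl exprn_ge0.
- by rewrite !expr0n/= !mul0r !addr0 subr0 normr0 mulr_ge0 ?invr_ge0// exprn_ge0.
Qed.

Let step3 y : R := c3 y - 3 * c3 (y - 1) + 3 * c3 (y - 2) - c3 (y - 3).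

Let measurable_step3 : measurable_fun setT step3.
Proof.
have mc (k : R) : measurable_fun setT (fun y => c3 (y - k)).
  rewrite /c3; apply: measurable_funM => //; apply: measurable_funX.
  by apply: measurable_maxr => //; exact: measurable_funB.
have mc0 : measurable_fun setT c3.
  by have := mc 0; under eq_fun do rewrite subr0.
rewrite /step3; apply: measurable_funB => //; apply: measurable_funD; last exact: measurable_funM.
by apply: measurable_funB => //; exact: measurable_funM.
Qed.

Let step3_le0 y : y <= 0 -> step3 y = 0.
Proof.
by move=> y0; rewrite /step3 /c3 !max_l; [field|lra..].
Qed.

Let step3_ge3 y : 3 <= y -> step3 y = 1.
Proof.
by move=> y0; rewrite /step3 /c3 !max_r; [field|lra..].
Qed.

Let step3_unit_range y : 0 <= step3 y <= 1.
Proof.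
have [y0|y0] := leP y 0; first by rewrite step3_le0//; lra.
have [y3|y3] := leP 3 y; first by rewrite step3_ge3//; lra.
rewrite /step3 /c3 (@max_r _ _ 0 y) ?(@max_l _ _ 0 (y - 3)); [|lra..].
have [y1|y1] := leP y 1.
  rewrite !max_l; [|lra..].
  have -> : y ^+ 3 / 6 - 3 * (0 ^+ 3 / 6) + 3 * (0 ^+ 3 / 6) - 0 ^+ 3 / 6 = y ^+ 3 / 6 by field.
  rewrite divr_ge0 ?exprn_ge0 ?(ltW y0)//=.
  have : y ^+ 3 <= 1 by rewrite exprn_ile1// ltW.
  lra.
rewrite (@max_r _ _ 0 (y - 1)); last lra.
have [y2|y2] := leP y 2.
  rewrite max_l; last lra.
  have -> : y ^+ 3 / 6 - 3 * ((y - 1) ^+ 3 / 6) + 3 * (0 ^+ 3 / 6) - 0 ^+ 3 / 6 =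
     (y ^+ 3 - 3 * (y - 1) ^+ 3) / 6 by field.
  rewrite !exprS expr0 !mulr1.
  have H : 0 <= (y - 1) * (2 - y) by rewrite mulr_ge0; lra.
  have H1 : 0 <= (y - 1) * (2 - y) * (y - 1) by rewrite mulr_ge0//; lra.
  apply/andP; split; nra.
rewrite max_r; last lra.
have -> : y ^+ 3 / 6 - 3 * ((y - 1) ^+ 3 / 6) + 3 * ((y - 2) ^+ 3 / 6) - 0 ^+ 3 / 6 =
   1 - (3 - y) ^+ 3 / 6 by field.
have h0 : 0 <= (3 - y) ^+ 3 by rewrite exprn_ge0; lra.
have h1 : (3 - y) ^+ 3 <= 1 by rewrite exprn_ile1; lra.
lra.
Qed.

(** The four remainders add up to [(1 + 3 + 3 + 1) / 6], and [h2] is a third difference of [max 0],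
    which vanishes outside [[0, 3]]; 12 is a generous common bound. *)
Let step3_taylor : taylor3 12 step3.
Proof.
pose m0 y : R := Num.max 0 y.
exists (fun a => m0 a ^+ 2 / 2 - 3 * (m0 (a - 1) ^+ 2 / 2) + 3 * (m0 (a - 2) ^+ 2 / 2)
   - m0 (a - 3) ^+ 2 / 2).
exists (fun a => m0 a - 3 * m0 (a - 1) + 3 * m0 (a - 2) - m0 (a - 3)); split.
  move=> a; rewrite /m0.
  case: (leP 0 a) => ?; case: (leP 0 (a - 1)) => ?; case: (leP 0 (a - 2)) => ?;
    case: (leP 0 (a - 3)) => ?; rewrite ler_norml; lra.
move=> u a.
pose r k := c3 (u - k) - (c3 (a - k) + m0 (a - k) ^+ 2 / 2 * (u - a) +
  m0 (a - k) / 2 * (u - a) ^+ 2).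
have H k : `|r k| <= 6^-1 * `|u - a| ^+ 3.
  by have := c3_taylor (u - k) (a - k); rewrite opprB addrA subrK.
rewrite [X in `|X|](_ : _ = r 0 - 3 * r 1 + 3 * r 2 - r 3); last first.
  by rewrite /r /step3 !subr0; field.
have := H 0; have := H 1; have := H 2; have := H 3.
have : 0 <= `|u - a| ^+ 3 by rewrite exprn_ge0.
by rewrite !ler_norml; lra.
Qed.

Lemma smooth_indicator (t e : R) : 0 < e ->
  exists K f, [/\ unit_valued f, taylor3 K f, forall y, y <= t -> f y = 1 &
    forall y, t + e <= y -> f y = 0].
Proof.
move=> e0; pose d := e / 3; have d0 : 0 < d by rewrite divr_gt0.
have d2 : 0 < d ^- 2 by rewrite invr_gt0 exprn_gt0.
have d3 : 0 < d ^- 3 by rewrite invr_gt0 exprn_gt0.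
have [h1 [h2 [h2K hP]]] := step3_taylor.
(* [step3] climbs over a length 3, hence [d = e / 3]. Rescaling multiplies the second-order
   coefficient by [d^-2] and the cubic remainder by [d^-3]; the sum covers both. *)
exists (12 * (d ^- 2 + d ^- 3)), (fun y => 1 - step3 ((y - t) / d)); split.
- split; last by move=> u; have := step3_unit_range ((u - t) / d); lra.
  apply: measurable_funB => //; apply: measurableT_comp => //.
  by apply: measurable_funM => //; exact: measurable_funB.
- exists (fun a => - h1 ((a - t) / d) / d), (fun a => - h2 ((a - t) / d) / d ^+ 2); split.
    move=> a; rewrite normrM normrN [`|d ^- 2|]gtr0_norm//.
    by apply: le_trans (ler_wpM2r (ltW d2) (h2K _)) _; rewrite ler_wpM2l// lerDl ltW.
  move=> u a.
  have -> : 1 - step3 ((u - t) / d) - (1 - step3 ((a - t) / d) +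
     - h1 ((a - t) / d) / d * (u - a) + - h2 ((a - t) / d) / d ^+ 2 / 2 * (u - a) ^+ 2) =
     - (step3 ((u - t) / d) - (step3 ((a - t) / d) + h1 ((a - t) / d) * ((u - t) / d - (a - t) / d)
      + h2 ((a - t) / d) / 2 * ((u - t) / d - (a - t) / d) ^+ 2)).
    by field; rewrite gt_eqF.
  rewrite normrN; apply: le_trans (hP _ _) _.
  have -> : (u - t) / d - (a - t) / d = (u - a) / d by field; rewrite gt_eqF.
  rewrite normrM normfV (gtr0_norm d0) exprMn exprVn.
  rewrite [_ / d ^+ 3]mulrC mulrA ler_wpM2r ?exprn_ge0// ler_wpM2l// lerDr.
  exact: ltW.
- move=> y yt; rewrite step3_le0 ?subr0// pmulr_lle0 ?invr_gt0//; lra.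
- move=> y yt; rewrite step3_ge3 ?subrr// ler_pdivlMr// /d; lra.
Qed.

End spline.

(** * Sums of independent finitely valued variables *)

Definition le_ind {R : realType} (t y : R) : R := ((y <= t)%R : bool)%:R.

Section iid.
Context {d : measure_display} {T : measurableType d} {R : realType}.
Context (P : probability T R) (Y : nat -> T -> R).
Hypotheses (mY : forall j, measurable_fun setT (Y j)) (iY : mutually_independent P Y).
Context (I : finType) (c : R -> I) (q x : I -> R).
Hypothesis mc : forall i, measurable (c @^-1` [set i]).
Hypothesis cq : forall j i, P (Y j @^-1` (c @^-1` [set i])) = (q i)%:E.

(* [l] summands are already fixed to [s], and [r] of them remain. *)
Let ev (t : R) (r l : nat) (s : nat -> I) (a : R) : set T :=
  [set w | (forall j, (j < l)%N -> c (Y j w) = s j) /\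
           a + \sum_(l <= j < l + r) x (c (Y j w)) <= t].

(** Induction on the number [r] of free summands, splitting on the value of the next one: each split
    is one application of [avgshift]. Once all values are fixed, the product rule for the cells
    finishes. Measurability is carried along because additivity over the split needs it. *)
Let evE t r l s a : measurable (ev t r l s a) /\
  P (ev t r l s a) =
    ((\prod_(j < l) q (s j)) * iter r (avgshift I q x) (le_ind t) a)%:E.
Proof.
elim: r l s a => [|r IH] l s a.
  have evl w : ev t 0 l s a w <->
      (forall j, (j < l)%N -> (c @^-1` [set s j]) (Y j w)) /\ a <= t.
    by rewrite /ev /= addn0 big_geq// addr0.
  have [at_|at_] := boolP (a <= t); last first.
    rewrite (_ : ev _ _ _ _ _ = set0); last first.
      by apply/seteqP; split => w // /evl[_]; rewrite (negbTE at_).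
    by rewrite /= /le_ind (negbTE at_) mulr0 measure0; split.
  rewrite (_ : ev _ _ _ _ _ =
      [set w | forall j, (j < l)%N -> (c @^-1` [set s j]) (Y j w)]); last first.
    by apply/seteqP; split => w; rewrite evl /=; [case|].
  split.
    rewrite (_ : [set _ | _] = \bigcap_(j in `I_l) (Y j @^-1` (c @^-1` [set s j]))).
      apply: fin_bigcap_measurable => // j _.
      by rewrite -[X in measurable X]setTI; exact: mY.
    by apply/seteqP; split => w /=.
  rewrite (iY l (fun j => c @^-1` [set s j]))// /= /le_ind at_ mulr1.
  rewrite (big_morph EFin EFinM erefl); apply: eq_bigr => j _.
  exact: cq.
pose s' i j := if j == l then i else s j.
have evU : ev t r.+1 l s a = \bigcup_(i in [set` index_enum I]) ev t r l.+1 (s' i) (a + x i).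
  apply/seteqP; split => w.
    move=> [H1 H2]; exists (c (Y l w)); [exact: mem_index_enum|split].
      move=> j; rewrite ltnS leq_eqVlt /s' => /orP[/eqP ->|jl]; first by rewrite eqxx.
      by rewrite ltn_eqF// H1.
    by move: H2; rewrite addnS big_ltn ?ltnS ?leq_addr// addrA addSn.
  move=> [i _ [H1 H2]]; have ci : c (Y l w) = i by rewrite H1// /s' eqxx.
  split=> [j jl|]; first by rewrite H1 1?ltnW// /s' ltn_eqF.
  by rewrite addnS big_ltn ?ltnS ?leq_addr// addrA -addSn ci.
have tr : trivIset [set` index_enum I] (fun i => ev t r l.+1 (s' i) (a + x i)).
  move=> i j _ _ [w [[/(_ l (ltnSn l)) Hi _] [/(_ l (ltnSn l)) Hj _]]].
  by move: Hi Hj; rewrite /s' eqxx => <- <-.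
split.
  rewrite evU; apply: fin_bigcup_measurable => // i _.
  by have [] := IH l.+1 (s' i) (a + x i).
rewrite evU measure_fin_bigcup//; last by move=> i _; have [] := IH l.+1 (s' i) (a + x i).
rewrite -fsbig_seq ?index_enum_uniq//=.
rewrite /= [in RHS]/avgshift mulr_sumr -sumEFin; apply: eq_bigr => i _.
have [_ ->] := IH l.+1 (s' i) (a + x i).
rewrite big_ord_recr /= /s' eqxx mulrA; congr ((_ * _ * _)%:E).
by apply: eq_bigr => j _; rewrite ltn_eqF.
Qed.

Lemma iid_sum_law n (t : R) :
  P [set w | \sum_(j < n) x (c (Y j w)) <= t] =
  (iter n (avgshift I q x) (le_ind t) 0)%:E.
Proof.
(* [c 0] supplies an inhabitant of [I]; with [l = 0] any sequence will do. *)
have [_] := evE t n 0 (fun=> c 0) 0; rewrite big_ord0 mul1r => <-; congr (P _).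
apply/seteqP; split => w; rewrite /ev /= add0r add0n big_mkord; first by [].
by case.
Qed.
End iid.

(** * The central limit theorem for triangular arrays *)

Lemma invsqrt_cvg0 {R : realType} : (fun n => (Num.sqrt n%:R)^-1) @ \oo --> (0 : R).
Proof.
apply/(@gtr0_cvgV0 _ _ _ _ (fun n => Num.sqrt n%:R : R)).
  by near=> n; rewrite sqrtr_gt0 ltr0n; near: n; exact: nbhs_infty_gt.
apply/cvgryPge => A.
have [M HM] : exists M : nat, A ^+ 2 <= M%:R.
  by exists (Num.truncn (A ^+ 2)).+1; apply/ltW/truncnS_gt.
near=> n; apply: le_trans (ler_norm A) _; rewrite -sqrtr_sqr ler_sqrt//.
by apply: (le_trans HM); rewrite ler_nat; near: n; exact: nbhs_infty_ge.
Unshelve. all: by end_near. Qed.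

Section clt.
Context {R : realType}.
Local Notation mu := (@lebesgue_measure R).
Implicit Types t y : R.

Lemma le_ind_unit_valued t : unit_valued (le_ind t).
Proof.
split; last by move=> u; rewrite /le_ind; case: (u <= t); rewrite /= ?lexx ?ler01.
rewrite (_ : le_ind t = \1_`]-oo, t]); first exact: measurable_indic.
by apply/funext => u; rewrite /le_ind indicE mem_setE in_itv.
Qed.

Lemma gauss_avg_le_ind (s t : R) : gauss_avg s (le_ind t) 0 = fine (normal_prob 0 s `]-oo, t]).
Proof.
rewrite /gauss_avg /Rintegral; congr fine; rewrite /normal_prob [RHS]integral_mkcond/=.
apply: eq_integral => u _; rewrite /patch /le_ind mem_setE in_itv/=.
by case: (u <= t); rewrite ?mul1r ?mul0r.
Qed.

Lemma gauss_avg_le f g (s a : R) : unit_valued f -> unit_valued g ->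
  (forall u, f u <= g u) -> gauss_avg s f a <= gauss_avg s g a.
Proof.
move=> hf hg fg; apply: le_Rintegral => //; [exact: unit_valued_integrable..|].
by move=> u _; rewrite ler_wpM2r ?normal_pdf_ge0.
Qed.

(** The normal distribution function is Lipschitz, with the peak of the density as constant. This
    pays for the gap between an indicator and its smoothing. *)
Lemma gauss_avg_le_indD (s t e : R) : s != 0 -> 0 <= e ->
  gauss_avg s (le_ind (t + e)) 0 <= gauss_avg s (le_ind t) 0 + normal_peak s * e.
Proof.
move=> s0 e0; rewrite !gauss_avg_le_ind.
have -> : `]-oo, (t + e)%R]%classic = `]-oo, t]%classic `|` `]t, (t + e)%R]%classic.
  by rewrite -itv_bndbnd_setU// bnd_simp lerDl.
rewrite measureU//; last first.
  by rewrite -subset0 => u [] /=; rewrite !in_itv/= => ut /andP[]; rewrite ltNge ut.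
rewrite fineD ?fin_num_measure//; rewrite lerD2l -[leRHS]/(fine (normal_peak s * e)%:E).
rewrite fine_le ?fin_num_measure// /normal_prob.
apply: (@le_trans _ _ (\int[mu]_(u in `]t, (t + e)%R]) (normal_peak s)%:E)%E).
  apply: ge0_le_integral => //.
  - by move=> u _; rewrite lee_fin normal_pdf_ge0.
  - by apply/measurable_EFinP; apply: measurable_funTS; exact: measurable_normal_pdf.
  - by move=> u _; rewrite lee_fin normal_pdf_ub.
rewrite integral_cst//= lebesgue_measure_itv/= lte_fin ltrDl.
case: ifPn => [_|]; first by rewrite -EFinD addrAC subrr add0r -EFinM.
by rewrite mule0 lee_fin mulr_ge0// normal_peak_ge0.
Qed.

Lemma iter_avgshift_le (I : finType) (q x : I -> R) n f g a : (forall i, 0 <= q i) ->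
  (forall u, f u <= g u) -> iter n (avgshift I q x) f a <= iter n (avgshift I q x) g a.
Proof.
move=> q0 fg; elim: n a => [|n IH] a /=; first exact: fg.
by apply: ler_sum => i _; rewrite ler_wpM2l.
Qed.

Context (s : R) (N : nat -> nat) (I : nat -> finType) (q x : forall k, I k -> R).
Hypotheses (s0 : 0 < s) (q0 : forall k i, 0 <= q k i) (q1 : forall k, \sum_i q k i = 1)
  (qx : forall k, \sum_i q k i * x k i = 0).
Hypothesis Noo : N @ \oo --> \oo.
Hypothesis var_cvg : (fun k => (N k)%:R * \sum_i q k i * x k i ^+ 2) @ \oo --> s ^+ 2.
Hypothesis third_cvg : (fun k => (N k)%:R * \sum_i q k i * `|x k i| ^+ 3) @ \oo --> (0 : R).

Let near_N A : \forall k \near \oo, (A <= N k)%N.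
Proof. exact: (Noo _ (nbhs_infty_ge A)). Qed.

Let invsqrtN_cvg : (fun k => (Num.sqrt (N k)%:R)^-1) @ \oo --> (0 : R).
Proof. exact: (cvg_comp _ _ Noo (@invsqrt_cvg0 R)). Qed.

Lemma smooth_clt K f : unit_valued f -> taylor3 K f ->
  (fun k => iter (N k) (avgshift (I k) (q k) (x k)) f 0) @ \oo --> gauss_avg s f 0.
Proof.
move=> hf hT.
pose b k := K * (`|(N k)%:R * \sum_i q k i * x k i ^+ 2 - s ^+ 2| / 2 +
   (N k)%:R * \sum_i q k i * `|x k i| ^+ 3 + 64 * s ^+ 3 * (Num.sqrt (N k)%:R)^-1).
have b_cvg : b @ \oo --> K * (`|s ^+ 2 - s ^+ 2| * 2^-1 + 0 + 64 * s ^+ 3 * 0).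
  apply: cvgM; first exact: cvg_cst.
  apply: cvgD; last by apply: cvgM => //; exact: cvg_cst.
  apply: cvgD => //; apply: cvgM; last exact: cvg_cst.
  by apply: cvg_norm; apply: cvgB => //; exact: cvg_cst.
rewrite subrr normr0 mul0r mulr0 !addr0 mulr0 in b_cvg.
apply/cvgrPdist_le => e e0; near=> k.
have Nk : (0 < N k)%N by near: k; exact: near_N.
have sN0 : 0 < Num.sqrt (N k)%:R :> R by rewrite sqrtr_gt0 ltr0n.
(* Each step gets standard deviation [s / N^(1/2)], so that [N] steps compose to [s] while the
   Gaussian cubic terms total [64 s^3 / N^(1/2)], which tends to 0. *)
have := lindeberg (I k) (q k) (x k) (q0 k) (q1 k) (qx k) K f (s / Num.sqrt (N k)%:R) (N k).-1 0
  (divr_gt0 s0 sN0) hf hT.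
rewrite prednK// divfK ?gt_eqF// distrC => /le_trans; apply.
have -> : (N k)%:R * (K * one_step_error (I k) (q k) (x k) (s / Num.sqrt (N k)%:R)) = b k.
  rewrite /b /one_step_error.
  have NE : (N k)%:R = Num.sqrt (N k)%:R ^+ 2 :> R by rewrite sqr_sqrtr.
  have -> : (N k)%:R * \sum_i q k i * x k i ^+ 2 - s ^+ 2 =
      (N k)%:R * (\sum_i q k i * x k i ^+ 2 - (s / Num.sqrt (N k)%:R) ^+ 2).
    by rewrite mulrBr exprMn exprVn -NE mulrCA divff ?mulr1// pnatr_eq0 -lt0n.
  rewrite normrM (ger0_norm (ler0n _ (N k))).
  move: NE sN0; set ns := Num.sqrt _ => NE sN0; rewrite NE.
  by field; rewrite gt_eqF.
near: k; move/cvgrPdist_le : b_cvg => /(_ e e0); apply: filterS => k.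
by rewrite sub0r normrN; exact/le_trans/ler_norm.
Unshelve. all: end_near. Qed.

Theorem triangular_clt t :
  (fun k => iter (N k) (avgshift (I k) (q k) (x k)) (le_ind t) 0) @ \oo -->
  fine (normal_prob 0 s `]-oo, t]).
Proof.
rewrite -gauss_avg_le_ind; apply/cvgrPdist_le => e e0.
have sn0 : s != 0 by rewrite gt_eqF.
have pk : 0 < normal_peak s by exact: normal_peak_gt0.
(* Shifting the threshold by [dl] costs at most [e / 2] in Gaussian probability; the other half of
   [e] goes to the convergence for the two splines [f1] and [f2]. *)
pose dl := e / 2 / normal_peak s.
have dl0 : 0 < dl by rewrite !divr_gt0.
have pdl : normal_peak s * dl = e / 2 by rewrite /dl mulrC divfK// gt_eqF.
have [K1 [f1 [hf1 T1 f11 f10]]] := smooth_indicator t dl dl0.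
have [K2 [f2 [hf2 T2 f21 f20]]] := smooth_indicator (t - dl) dl dl0.
have c1 := smooth_clt K1 f1 hf1 T1; have c2 := smooth_clt K2 f2 hf2 T2.
have e20 : 0 < e / 2 by rewrite divr_gt0.
have ind1 u : le_ind t u <= f1 u.
  rewrite /le_ind; case: (leP u) => [ut|_]; first by rewrite f11.
  by have [_ /(_ u)/andP[]] := hf1.
have ind2 u : f2 u <= le_ind t u.
  rewrite /le_ind; case: (leP u) => [ut|tu]; first by have [_ /(_ u)/andP[]] := hf2.
  by rewrite f20// subrK ltW.
have ind3 u : f1 u <= le_ind (t + dl) u.
  rewrite /le_ind; case: (leP u) => [ut|tu]; first by have [_ /(_ u)/andP[]] := hf1.
  by rewrite f10// ltW.
have ind4 u : le_ind (t - dl) u <= f2 u.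
  rewrite /le_ind; case: (leP u) => [ut|_]; first by rewrite f21.
  by have [_ /(_ u)/andP[]] := hf2.
have G1 := gauss_avg_le _ _ s 0 hf1 (le_ind_unit_valued (t + dl)) ind3.
have G2 := gauss_avg_le _ _ s 0 (le_ind_unit_valued (t - dl)) hf2 ind4.
have D1 := gauss_avg_le_indD s t dl sn0 (ltW dl0).
have D2 := gauss_avg_le_indD s (t - dl) dl sn0 (ltW dl0); rewrite subrK in D2.
rewrite pdl in D1 D2.
near=> k.
have I1 := iter_avgshift_le (I k) (q k) (x k) (N k) _ _ 0 (q0 k) ind1.
have I2 := iter_avgshift_le (I k) (q k) (x k) (N k) _ _ 0 (q0 k) ind2.
have : `|gauss_avg s f1 0 - iter (N k) (avgshift (I k) (q k) (x k)) f1 0| <= e / 2.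
  by near: k; move/cvgrPdist_le : c1; apply.
have : `|gauss_avg s f2 0 - iter (N k) (avgshift (I k) (q k) (x k)) f2 0| <= e / 2.
  by near: k; move/cvgrPdist_le : c2; apply.
rewrite !ler_norml => /andP[A1 A2] /andP[B1 B2]; apply/andP; split; lra.
Unshelve. all: end_near. Qed.

End clt.

(** * Binomial weights *)

Section binomial.
Context {R : realType}.
Implicit Types (x y t : R) (f g : nat -> R) (M : nat).
Local Notation mu := (@lebesgue_measure R).

Definition binE M x f : R := \sum_(i < M.+1) bern i M x * f i.

(** Conditioning on one Bernoulli trial. Normalisation, variance and characteristic function all
    follow from it by induction on [M]. *)
Lemma binE_rec M x f :
  binE M.+1 x f = (1 - x) * binE M x f + x * binE M x (fun i => f i.+1).
Proof.
have b0 : bern 0 M.+1 x = (1 - x) * bern 0 M x.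
  by rewrite /bern !bin0 !expr0 !mul1r !subn0 exprS.
have bS i : (i < M.+1)%N -> bern i.+1 M.+1 x = x * bern i M x + (1 - x) * bern i.+1 M x.
  rewrite ltnS /bern subSS binS natrD => iM.
  have [iM1|Mi] := ltnP i M.
    have -> : (1 - x) ^+ (M - i) = (1 - x) * (1 - x) ^+ (M - i.+1) by rewrite -exprS subnSK.
    by rewrite exprS; ring.
  by rewrite (_ : i = M) ?binn ?bin_small//; [rewrite exprS; ring|apply/eqP; rewrite eqn_leq iM].
rewrite /binE big_ord_recl /= b0.
rewrite (eq_bigr (fun i : 'I_M.+1 =>
    x * (bern i M x * f i.+1) + (1 - x) * (bern i.+1 M x * f i.+1)));
  last by move=> i _; rewrite /bump add1n bS//; ring.
rewrite big_split /= -!mulr_sumr addrCA [RHS]addrC; congr (_ + _).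
rewrite -mulrA -mulrDr; congr (_ * _).
rewrite [RHS]big_ord_recl big_ord_recr /=; congr (_ + _).
rewrite {2}/bern bin_small// !mul0r addr0.
by apply: eq_bigr => i _; rewrite /bump add1n.
Qed.

Lemma binE0 x f : binE 0 x f = f 0%N.
Proof. by rewrite /binE big_ord1 /bern bin0 !expr0 !mul1r. Qed.

Lemma eq_binE M x f g : f =1 g -> binE M x f = binE M x g.
Proof. by move=> fg; apply: eq_bigr => i _; rewrite fg. Qed.

Lemma binED M x f g : binE M x (fun i => f i + g i) = binE M x f + binE M x g.
Proof. by rewrite /binE -big_split; apply: eq_bigr => i _; rewrite mulrDr. Qed.

Lemma binEZ M x (c : R) f : binE M x (fun i => c * f i) = c * binE M x f.
Proof. by rewrite /binE mulr_sumr; apply: eq_bigr => i _; rewrite mulrCA. Qed.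

Lemma binE_cst M x (c : R) : binE M x (fun=> c) = c.
Proof. by elim: M => [|M IH]; rewrite ?binE0// binE_rec IH; ring. Qed.

Lemma binE_var M x :
  binE M x (fun i => (i%:R - M%:R * x) ^+ 2) = M%:R * (x * (1 - x)).
Proof.
elim: M => [|M IH]; first by rewrite binE0 !mul0r subr0 expr0n.
rewrite binE_rec.
rewrite (@eq_binE _ _ _ (fun i => (i%:R - M%:R * x) ^+ 2 +
    ((- 2 * x) * (i%:R - M%:R * x) + x ^+ 2))); last by move=> i; rewrite -(@natr1 _ M); ring.
rewrite (@eq_binE _ _ (fun i => (i.+1%:R - _) ^+ 2) (fun i => (i%:R - M%:R * x) ^+ 2 +
    ((2 * (1 - x)) * (i%:R - M%:R * x) + (1 - x) ^+ 2))); last first.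
  by move=> i; rewrite -(@natr1 _ M) -(@natr1 _ i); ring.
have -> : M.+1%:R * (x * (1 - x)) = binE M x (fun i => (i%:R - M%:R * x) ^+ 2) + x * (1 - x).
  by rewrite IH -(@natr1 _ M); ring.
(* The coefficients [- 2 * x] and [2 * (1 - x)] of the linear deviation cancel in the mixture, so
   the first moment stays out of the induction. *)
rewrite !binED !binEZ !binE_cst.
by ring.
Qed.

Lemma bern_ge0 i M x : 0 <= x <= 1 -> 0 <= bern i M x.
Proof.
by move=> /andP[x0 x1]; rewrite /bern !mulr_ge0 ?exprn_ge0// subr_ge0.
Qed.

Lemma bern_sum1 M x : \sum_(i < M.+1) bern i M x = 1.
Proof.
rewrite -[RHS](binE_cst M x 1); apply: eq_bigr => i _; by rewrite mulr1.
Qed.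

(** Chebyshev at a single point: one term of the variance sum is at most the whole, which is at most
    [M]. Deviations proportional to [M] turn this into a bound of order [1/M]. *)
Lemma bern_far (i : nat) M x e : 0 <= x <= 1 -> 0 < e -> (i <= M)%N ->
  e * M.+1%:R <= `|i%:R - M%:R * x| -> bern i M x <= e ^- 2 / M.+1%:R.
Proof.
move=> x01 e0 iM far.
have M0 : 0 < M.+1%:R :> R by [].
have : bern i M x * (e * M.+1%:R) ^+ 2 <= M.+1%:R.
  apply: (@le_trans _ _ (binE M x (fun i => (i%:R - M%:R * x) ^+ 2))).
    rewrite /binE (bigD1 (Ordinal (iM : (i < M.+1)%N)))//=.
    rewrite -[leLHS]addr0 lerD//; last first.
      by apply: sumr_ge0 => j _; rewrite mulr_ge0 ?sqr_ge0 ?bern_ge0.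
    rewrite ler_wpM2l ?bern_ge0// -[leRHS]real_normK ?num_real//.
    by rewrite lerXn2r ?nnegrE// mulr_ge0// ltW.
  rewrite binE_var; apply: (@le_trans _ _ (M%:R * 1)).
    by rewrite ler_wpM2l//; case/andP: x01; nra.
  by rewrite mulr1 ler_nat.
have -> : e ^- 2 / M.+1%:R = M.+1%:R / (e * M.+1%:R) ^+ 2 by field; rewrite !gt_eqF.
by rewrite ler_pdivlMr// exprn_gt0// mulr_gt0.
Qed.

(** The squared modulus of the binomial characteristic function [(1 - x + x e^(it))^M], written with
    real and imaginary parts. *)
Lemma binE_cos_sin M x t :
  binE M x (fun i => cos (i%:R * t)) ^+ 2 + binE M x (fun i => sin (i%:R * t)) ^+ 2
  = (1 - 2 * x * (1 - x) * (1 - cos t)) ^+ M.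
Proof.
elim: M => [|M IH].
  by rewrite !binE0 !mul0r cos0 sin0 expr0n expr1n addr0.
rewrite [in RHS]exprS -IH !binE_rec.
rewrite (@eq_binE _ _ (fun i => cos (i.+1%:R * t)) (fun i => cos t * cos (i%:R * t) +
  (- sin t) * sin (i%:R * t))); last first.
  by move=> i; rewrite -natr1 mulrDl mul1r cosD; ring.
rewrite (@eq_binE _ _ (fun i => sin (i.+1%:R * t)) (fun i => cos t * sin (i%:R * t) +
  sin t * cos (i%:R * t))); last first.
  by move=> i; rewrite -natr1 mulrDl mul1r sinD; ring.
rewrite !binED !binEZ.
move: (binE M x _) (binE M x _) => C S.
have := cos2Dsin2 t; move: (cos t) (sin t) => c s cs.
transitivity ((C ^+ 2 + S ^+ 2) *
  ((1 - x) ^+ 2 + 2 * x * (1 - x) * c + x ^+ 2 * (c ^+ 2 + s ^+ 2))); first by ring.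
by rewrite cs; ring.
Qed.

End binomial.

(** * Parseval's identity for the binomial weights *)

Section parseval.
Context {R : realType}.
Implicit Types (x t : R) (M : nat).
Local Notation mu := (@lebesgue_measure R).

Lemma sin_natpi n : sin (n%:R * pi) = 0 :> R.
Proof.
by elim: n => [|n IH]; rewrite ?mul0r ?sin0// -natr1 mulrDl mul1r sinD IH sinpi mulr0 mul0r addr0.
Qed.

Lemma is_derive_sin_scaled (k t : R) : is_derive t 1 (fun t => sin (k * t)) (k * cos (k * t)).
Proof.
have H1 : is_derive t 1 (fun t : R => k * t) k.
  have -> : (fun t : R => k * t) = k *: (id : R -> R) by apply/funext.
  by apply: is_derive_eq; rewrite /GRing.scale/= mulr1.
by rewrite mulrC; apply: (@is_derive1_comp _ sin (fun t => k * t)).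
Qed.

Lemma continuous_itvcc_integrable (a b : R) f : continuous f ->
  mu.-integrable `[a, b] (fun t => (f t)%:E).
Proof.
move=> cf; apply: continuous_compact_integrable; first exact: segment_compact.
exact: continuous_subspaceT.
Qed.

Lemma continuous_cosM (k : R) : continuous (fun t => cos (k * t)).
Proof.
move=> t; apply: (@continuous_comp _ _ _ (fun t => k * t) cos); last exact: continuous_cos.
by apply: continuousM; [exact: cst_continuous|exact: cvg_id].
Qed.

Lemma Rintegral_cosM (k : R) : k != 0 ->
  \int[mu]_(t in `[- pi, pi]) cos (k * t) = 2 * sin (k * pi) / k.
Proof.
move=> k0; rewrite /Rintegral.
rewrite (@continuous_FTC2 _ _ (fun t => sin (k * t) / k)).
- by rewrite -EFinB /= mulrN sinN; field.
- by have := @pi_gt0 R; lra.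
- apply: continuous_subspaceT; exact: continuous_cosM.
- have dF t : derivable (fun t => sin (k * t) / k) t 1.
    apply: derivableM => //; have := is_derive_sin_scaled k t; exact: ex_derive.
  have cF : continuous (fun t => sin (k * t) / k).
    by move=> t; apply/differentiable_continuous/derivable1_diffP.
  split => //.
  + by apply: cvg_at_right_filter; exact: cF.
  + by apply: cvg_at_left_filter; exact: cF.
- move=> t _; rewrite derive1E.
  apply: derive_val.
  have -> : (fun t => sin (k * t) / k) = k^-1 *: (fun t => sin (k * t)).
    by apply/funext => u; rewrite mulrC.
  have H := is_derive_sin_scaled k t.
  have -> : cos (k * t) = k^-1 *: (k * cos (k * t)) by rewrite /GRing.scale/= mulKf.
  apply: is_deriveZ.
Qed.

Lemma Rintegral_orthogonal (i j : nat) :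
  \int[mu]_(t in `[- pi, pi]) (cos (i%:R * t) * cos (j%:R * t) + sin (i%:R * t) * sin (j%:R * t))
  = 2 * pi * (i == j)%:R.
Proof.
under eq_Rintegral do rewrite -cosB -mulrBl.
have [->|ij] := eqVneq i j.
  under eq_Rintegral do rewrite subrr mul0r cos0.
  rewrite Rintegral_cst//= lebesgue_measure_itv/= lte_fin.
  rewrite ifT; last by have := @pi_gt0 R; lra.
  by rewrite -EFinB/=; ring.
have k0 : i%:R - j%:R != 0 :> R by rewrite subr_eq0 eqr_nat.
rewrite Rintegral_cosM// mulr0 mulrBl sinB !sin_natpi.
by rewrite mul0r mulr0 subrr mulr0 mul0r.
Qed.

Lemma Rintegral_bigsum {d} {T : measurableType d} (nu : {measure set T -> \bar R})
    (I : Type) (s : seq I) (F : I -> T -> R) (D : set T) : measurable D ->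
  (forall i, nu.-integrable D (fun w => (F i w)%:E)) ->
  \int[nu]_(w in D) (\sum_(i <- s) F i w) = \sum_(i <- s) \int[nu]_(w in D) F i w.
Proof.
move=> mD hF; elim: s => [|i s IH].
  by rewrite big_nil; under eq_Rintegral do rewrite big_nil; rewrite Rintegral_cst// mul0r.
rewrite big_cons -IH -RintegralD//; last 2 first.
- exact: hF.
- have := @integrable_sum _ _ R nu D mD I s xpredT (fun j w => (F j w)%:E) (fun j _ => hF j).
  by apply: eq_integrable => // w _; rewrite sumEFin.
by apply: eq_Rintegral => w _; rewrite big_cons.
Qed.

Lemma bern_parseval M x :
  \int[mu]_(t in `[- pi, pi]) (1 - 2 * x * (1 - x) * (1 - cos t)) ^+ M =
  2 * pi * \sum_(i < M.+1) bern i M x ^+ 2.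
Proof.
pose G (p : 'I_M.+1 * 'I_M.+1) (t : R) :=
  cos (p.1%:R * t) * cos (p.2%:R * t) + sin (p.1%:R * t) * sin (p.2%:R * t).
pose F (p : 'I_M.+1 * 'I_M.+1) t := bern p.1 M x * bern p.2 M x * G p t.
transitivity (\int[mu]_(t in `[- pi, pi]) \sum_p F p t).
  apply: eq_Rintegral => t _; rewrite -binE_cos_sin /binE !expr2 !mulr_suml -big_split/=.
  rewrite -(pair_bigA _ (fun i j => F (i, j) t)) /=; apply: eq_bigr => i _.
  by rewrite !mulr_sumr -big_split; apply: eq_bigr => j _; rewrite /F /G /=; ring.
have cG p : continuous (G p).
  rewrite (_ : G p = fun t => cos ((p.1%:R - p.2%:R) * t)).
    exact: continuous_cosM.
  by apply/funext => t; rewrite /G -cosB -mulrBl.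
have IG p := continuous_itvcc_integrable (- pi) pi (G p) (cG p).
rewrite Rintegral_bigsum//; last first.
  move=> p; have := integrableZl _ (bern p.1 M x * bern p.2 M x) (IG p).
  by move=> /(_ (measurable_itv _)); apply: eq_integrable.
transitivity (\sum_(p : 'I_M.+1 * 'I_M.+1)
    bern p.1 M x * bern p.2 M x * (2 * pi * (p.1 == p.2)%:R)).
  apply: eq_bigr => p _; rewrite RintegralZl//.
    by rewrite Rintegral_orthogonal.
  exact: IG.
rewrite -(pair_bigA _ (fun i j : 'I_M.+1 => bern i M x * bern j M x * (2 * pi * (i == j)%:R))) /=.
rewrite mulr_sumr; apply: eq_bigr => i _; rewrite (bigD1 i)//= big1 ?addr0.
  by rewrite eqxx mulr1; ring.
by move=> j ji; rewrite eq_sym (negbTE ji) !mulr0.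
Qed.

End parseval.

(** * Laplace asymptotics of the sum of squared binomial weights *)

Section trig_bounds.
Context {R : realType}.
Implicit Types (t : R).

(** Starting from [cos <= 1], four applications yield the alternating Taylor bounds for sine and
    cosine, each one bounding the derivative needed for the next. *)
Lemma derive_ge0_le0 (f df : R -> R) : (forall t, is_derive t 1 f (df t)) ->
  (forall t, 0 <= t -> 0 <= df t) -> forall t, 0 <= t -> f 0 <= f t.
Proof.
move=> hf df0 t; rewrite le_eqVlt => /predU1P[<-//|t0].
have [] := MVT t0 (fun u _ => hf u).
  by apply: derivable_within_continuous => u _; case: (hf u).
move=> c; rewrite in_itv/= => /andP[c0 _]; rewrite subr0 => E.
by rewrite -subr_ge0 E mulr_ge0 ?df0 ?ltW.
Qed.

Lemma is_derive_monomial (c : R) n t :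
  is_derive t 1 (fun t => c * t ^+ n.+1) (c * (n.+1%:R * t ^+ n)).
Proof.
have H : is_derive t 1 (fun t : R => t ^+ n.+1) (n.+1%:R * t ^+ n).
  have := @is_deriveX R R id n.+1 t 1 1 (is_derive_id t 1).
  by rewrite /GRing.scale/= mulr1 exprfctE.
exact: (@is_deriveZ R R R _ c t 1 _ H).
Qed.

Lemma is_derive_add (f g : R -> R) df dg t : is_derive t 1 f df -> is_derive t 1 g dg ->
  is_derive t 1 (fun t => f t + g t) (df + dg).
Proof. by move=> hf hg; exact: (@is_deriveD R R R f g t 1 df dg hf hg). Qed.

Lemma sin_le_id t : 0 <= t -> sin t <= t.
Proof.
move=> t0.
have := derive_ge0_le0 (fun t => 1 * t ^+ 1 + - sin t) (fun t => 1 * (1 * t ^+ 0) + - cos t).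
move=> /(_ _ _ t t0); rewrite sin0 expr0n mulr0 subr0 mul1r expr1 subr_ge0; apply.
- by move=> u; apply: is_derive_add; exact: is_derive_monomial.
- by move=> u _; rewrite !mul1r expr0 subr_ge0 cos_le1.
Qed.

Lemma cos_ge_quadratic t : 0 <= t -> 1 - t ^+ 2 / 2 <= cos t.
Proof.
move=> t0.
have := derive_ge0_le0 (fun t => 2^-1 * t ^+ 2 + cos t) (fun t => 2^-1 * (2 * t ^+ 1) + - sin t).
move=> /(_ _ _ t t0); rewrite cos0 expr0n mulr0 add0r => H.
rewrite lerBlDl mulrC; apply: H.
- by move=> u; apply: is_derive_add; exact: is_derive_monomial.
- by move=> u u0; rewrite mulrA mulVf// mul1r subr_ge0 sin_le_id.
Qed.

Lemma sin_ge_cubic t : 0 <= t -> t - t ^+ 3 / 6 <= sin t.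
Proof.
move=> t0.
have := derive_ge0_le0 (fun t => (6^-1 * t ^+ 3 + -1 * t ^+ 1) + sin t)
  (fun t => (6^-1 * (3 * t ^+ 2) + -1 * (1 * t ^+ 0)) + cos t).
move=> /(_ _ _ t t0); rewrite sin0 !expr0n !mulr0 !addr0 => H.
suff : 0 <= 6^-1 * t ^+ 3 + -1 * t ^+ 1 + sin t by rewrite expr1; lra.
apply: H.
- by move=> u; apply: is_derive_add; apply: is_derive_add; exact: is_derive_monomial.
- by move=> u u0; have := cos_ge_quadratic _ u0; rewrite expr0; lra.
Qed.

Lemma cos_le_quartic t : 0 <= t -> cos t <= 1 - t ^+ 2 / 2 + t ^+ 4 / 24.
Proof.
move=> t0.
have := derive_ge0_le0 (fun t => (24^-1 * t ^+ 4 + - 2^-1 * t ^+ 2) + - cos t)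
  (fun t => (24^-1 * (4 * t ^+ 3) + - 2^-1 * (2 * t ^+ 1)) + - - sin t).
move=> /(_ _ _ t t0); rewrite cos0 !expr0n !mulr0 !add0r => H.
suff : -1 <= 24^-1 * t ^+ 4 + - 2^-1 * t ^+ 2 + - cos t by lra.
apply: H.
- by move=> u; apply: is_derive_add; apply: is_derive_add; exact: is_derive_monomial.
- by move=> u u0; have := sin_ge_cubic _ u0; rewrite expr1; lra.
Qed.

Lemma cos_taylor t : `|1 - cos t - t ^+ 2 / 2| <= t ^+ 4 / 24.
Proof.
rewrite -cos_norm -[t ^+ 2]real_normK ?num_real//.
rewrite [t ^+ 4](exprM _ 2 2) -[t ^+ 2]real_normK ?num_real// -exprM.
have t0 := normr_ge0 t; have := cos_ge_quadratic _ t0; have := cos_le_quartic _ t0.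
have : 0 <= `|t| ^+ 4 by rewrite exprn_ge0.
by rewrite ler_norml; lra.
Qed.

(** Put [y = |t| / 2 <= 2]. Then [1 - cos t = 2 sin^2 y], and the cubic bound gives
    [sin y >= y - y^3 / 6 >= y / 3], whence the 18. *)
Lemma onem_cos_ge t : `|t| <= pi -> t ^+ 2 / 18 <= 1 - cos t.
Proof.
move=> tpi; pose y := `|t| / 2.
have y0 : 0 <= y by rewrite divr_ge0.
have y2 : y <= 2 by have := @pihalf_lt2 R; rewrite /y; lra.
have ty : t ^+ 2 = 4 * y ^+ 2 by rewrite -[t ^+ 2]real_normK ?num_real// /y; field.
have -> : cos t = 1 - 2 * sin y ^+ 2.
  have -> : cos t = cos (y *+ 2) by rewrite -cos_norm mulr2n /y; congr cos; field.
  by rewrite cos_mulr2n cos2sin2 mulr2n; ring.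
have : y / 3 <= sin y.
  apply: le_trans (sin_ge_cubic _ y0).
  have : y * y * (y * 1) <= 2 * 2 * (y * 1) by rewrite ler_wpM2r ?mulr1// ler_pM.
  rewrite !exprS expr0; nra.
have y30 : 0 <= y / 3 by rewrite divr_ge0.
move=> H; have : y / 3 * (y / 3) <= sin y * sin y by rewrite ler_pM.
by rewrite ty !expr2; lra.
Qed.

Lemma expRN_taylor t : 0 <= t -> `|expR (- t) - (1 - t)| <= t ^+ 2.
Proof.
move=> t0; rewrite ger0_norm; last by rewrite subr_ge0; exact: expR_ge1Dx.
have : (1 + t / 2) * (1 + t / 2) <= expR t.
  have -> : t = t / 2 + t / 2 by field.
  rewrite expRD; have -> : (t / 2 + t / 2) / 2 = t / 2 by field.
  have := expR_ge1Dx (t / 2).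
  by move=> H; apply: ler_pM => //; rewrite addr_ge0// divr_ge0.
rewrite lerBlDl expRN => H.
have p : 0 < (1 + t / 2) * (1 + t / 2) by rewrite mulr_gt0// ltr_pwDl// divr_ge0.
apply: (@le_trans _ _ ((1 + t / 2) * (1 + t / 2))^-1).
  by rewrite lef_pV2 ?posrE ?expR_gt0.
rewrite -[leLHS]mul1r ler_pdivrMr// !expr2; nra.
Qed.

Lemma expr_diff (a b r : R) n : 0 <= a <= r -> 0 <= b <= r ->
  `|a ^+ n.+1 - b ^+ n.+1| <= n.+1%:R * `|a - b| * r ^+ n.
Proof.
move=> /andP[a0 ar] /andP[b0 br]; elim: n => [|n IH].
  by rewrite !expr1 expr0 mul1r mulr1.
have r0 : 0 <= r by exact: le_trans ar.
rewrite exprS [b ^+ n.+2]exprS.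
have -> : a * a ^+ n.+1 - b * b ^+ n.+1 = a * (a ^+ n.+1 - b ^+ n.+1) + (a - b) * b ^+ n.+1 by ring.
apply: le_trans (ler_normD _ _) _; rewrite !normrM (ger0_norm a0) (ger0_norm (exprn_ge0 _ b0)).
have -> : n.+2%:R * `|a - b| * r ^+ n.+1 = r * (n.+1%:R * `|a - b| * r ^+ n) + `|a - b| * r ^+ n.+1.
  by rewrite -(natr1 n.+1) exprS; ring.
apply: lerD; first by rewrite ler_pM.
by rewrite ler_wpM2l// lerXn2r ?nnegrE.
Qed.

End trig_bounds.

(** * Comparison with a Gaussian integral *)

Section laplace.
Context {R : realType}.
Implicit Types (t c : R) (n : nat).
Local Notation mu := (@lebesgue_measure R).
Local Notation q := (Num.sqrt (pi *+ 2) : R).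

Lemma expR_normal (k t : R) : 0 < k ->
  expR (- (k * t ^+ 2 / 2)) = (Num.sqrt k)^-1 * q * normal_pdf 0 (Num.sqrt k)^-1 t.
Proof.
move=> k0; have sk : 0 < Num.sqrt k by rewrite sqrtr_gt0.
have q0 := @sqrt2pi_gt0 R.
rewrite normal_pdfP ?invr_gt0// [RHS]mulrA divff ?mul1r;
  last by rewrite gt_eqF// mulr_gt0// invr_gt0.
by congr expR; rewrite subr0 exprVn sqr_sqrtr ?ltW//; field; rewrite gt_eqF.
Qed.

(* Both bases are bounded by [exp (- c t^2 / 18)] and differ by at most [t^4]. *)
Lemma laplace_pointwise c n t : 0 < c <= 2^-1 ->
  `|((fun t => (1 - c * (1 - cos t)) ^+ n.+1) \_ `[- pi, pi]) t -
    expR (- ((n.+1%:R * c) * t ^+ 2 / 2))| <=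
  n.+1%:R * (t ^+ 4 * expR (- ((n%:R * c / 9) * t ^+ 2 / 2))).
Proof.
move=> /andP[c0 c2].
have t2 := sqr_ge0 t.
have t4 : t ^+ 4 = t ^+ 2 * t ^+ 2 by rewrite -exprD.
have Er : expR (- ((n%:R * c / 9) * t ^+ 2 / 2)) = expR (- (c * t ^+ 2 / 18)) ^+ n.
  by rewrite -expRM_natl; congr expR; field.
have Eb : expR (- ((n.+1%:R * c) * t ^+ 2 / 2)) = expR (- (c * t ^+ 2 / 2)) ^+ n.+1.
  by rewrite -expRM_natl; congr expR; field.
have br : expR (- (c * t ^+ 2 / 2)) <= expR (- (c * t ^+ 2 / 18)).
  have : 0 <= c * t ^+ 2 by rewrite mulr_ge0// ltW.
  by rewrite ler_expR; lra.
rewrite Er Eb /patch mem_setE in_itv/= -ler_norml; case: ifPn => [tpi|].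
  have ct := onem_cos_ge _ tpi.
  (* Here [c <= 1/2] matters: [1 - cos t] can reach 2. *)
  have a0 : 0 <= 1 - c * (1 - cos t).
    by have := cos_geN1 t; have := cos_le1 t; nra.
  have ar : 1 - c * (1 - cos t) <= expR (- (c * t ^+ 2 / 18)).
    apply: le_trans (expR_ge1Dx _); rewrite lerD2l lerN2 -mulrA ler_wpM2l//.
    exact: ltW.
  apply: le_trans (expr_diff _ _ (expR (- (c * t ^+ 2 / 18))) n _ _) _;
    [by rewrite a0 ar|by rewrite expR_ge0 br|].
  rewrite -[leLHS]mulrA ler_wpM2l// ler_wpM2r ?exprn_ge0 ?expR_ge0//.
  have H1 := cos_taylor t.
  have y0 : 0 <= c * t ^+ 2 / 2 by rewrite divr_ge0// mulr_ge0// ltW.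
  have H2 := expRN_taylor _ y0.
  have -> : 1 - c * (1 - cos t) - expR (- (c * t ^+ 2 / 2)) =
    - (c * (1 - cos t - t ^+ 2 / 2)) - (expR (- (c * t ^+ 2 / 2)) - (1 - c * t ^+ 2 / 2)).
    by field.
  apply: le_trans (ler_normB _ _) _.
  rewrite normrN normrM (gtr0_norm c0).
  have H3 : c * `|1 - cos t - t ^+ 2 / 2| <= 1 * (t ^+ 4 / 24).
    by apply: ler_pM => //; [exact: ltW|lra].
  have H4 : (c * t ^+ 2 / 2) ^+ 2 <= t ^+ 4 / 4.
    have -> : (c * t ^+ 2 / 2) ^+ 2 = c ^+ 2 * (t ^+ 4 / 4) by rewrite t4; field.
    rewrite ler_piMl// ?t4; first by rewrite divr_ge0// mulr_ge0.
    by rewrite exprn_ile1//; [exact: ltW|lra].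
  have : 0 <= t ^+ 4 by rewrite t4 mulr_ge0.
  by move: H2 H3 H4; lra.
(* Outside the interval the truncated integrand is 0, and [t^4 >= 1] lets the same bound absorb the
   Gaussian tail. *)
rewrite -ltNge => tpi; rewrite sub0r normrN ger0_norm ?exprn_ge0 ?expR_ge0//.
have t1 : 1 <= t ^+ 4.
  rewrite t4 -[t ^+ 2]real_normK ?num_real//.
  have := @pi_ge2 R; move: tpi; move: (`|t|) pi => u p up p2.
  by have : 1 <= u ^+ 2; [rewrite expr2; nra|move=> ?; nra].
rewrite exprS.
have b1 : expR (- (c * t ^+ 2 / 2)) <= 1.
  by rewrite -expR0 ler_expR oppr_le0 divr_ge0// mulr_ge0// ltW.
apply: (@le_trans _ _ (1 * (1 * expR (- (c * t ^+ 2 / 18)) ^+ n))).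
  rewrite mul1r; apply: ler_pM => //; rewrite ?exprn_ge0 ?expR_ge0//.
  by rewrite lerXn2r ?nnegrE ?expR_ge0.
apply: ler_pM => //; rewrite ?mulr_ge0 ?exprn_ge0 ?expR_ge0 ?ler1n//.
by rewrite ler_wpM2r ?exprn_ge0 ?expR_ge0.
Qed.

(** Integrating the pointwise bound costs a fourth moment of a Gaussian of width [(n c / 9)^(-1/2)],
    that is, a fifth power of this width once the density is unnormalised. The error has order
    [n^(-3/2)], against [n^(-1/2)] for the main term. *)
Lemma laplace_bound c n : (0 < n)%N -> 0 < c <= 2^-1 ->
  `|\int[mu]_(t in `[- pi, pi]) (1 - c * (1 - cos t)) ^+ n.+1 -
    (Num.sqrt (n.+1%:R * c))^-1 * q| <=
  64 * n.+1%:R * (Num.sqrt (n%:R * c / 9)) ^- 5 * q.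
Proof.
move=> n0 c0c2; have /andP[c0 c2] := c0c2.
have nc0 : 0 < n%:R * c / 9 by rewrite divr_gt0// mulr_gt0// ltr0n.
have Mc0 : 0 < n.+1%:R * c by rewrite mulr_gt0.
have s1 : 0 < (Num.sqrt (n%:R * c / 9))^-1 by rewrite invr_gt0 sqrtr_gt0.
have q0 := @sqrt2pi_gt0 R.
have H t := laplace_pointwise c n t c0c2.
set s := (Num.sqrt (n.+1%:R * c))^-1; set s' := (Num.sqrt (n%:R * c / 9))^-1.
have I4 := dev_integrable 0 s' 4 s1 isT.
have IN := integrable_normal_pdf 0 s.
have e1 : (s * q) = \int[mu]_t (s * q * normal_pdf 0 s t).
  by rewrite RintegralZl// Rintegral_normal_pdf mulr1.
have IE := integrable_scale (normal_pdf 0 s) (s * q) IN.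
rewrite Rintegral_mkcond e1.
set f := _ \_ _.
have If : mu.-integrable setT (fun t => (f t)%:E).
  have : mu.-integrable `[- pi, pi] (fun t => ((1 - c * (1 - cos t)) ^+ n.+1)%:E).
    apply: continuous_itvcc_integrable.
    move=> t; apply: (@continuous_comp _ _ _ (fun t => 1 - c * (1 - cos t)) (fun y => y ^+ n.+1)).
      apply: cvgB; first exact: cvg_cst.
      apply: cvgM; first exact: cvg_cst.
      by apply: cvgB; [exact: cvg_cst|exact: continuous_cos].
    exact: exprn_continuous.
  move=> /integrable_mkcond => /(_ (measurable_itv _)).
  by apply: eq_integrable => // t _; rewrite /f /patch; case: ifP.
rewrite -RintegralB//.
apply: le_trans (le_normr_Rintegral _ _) _ => //.
  by apply: eq_integrable (integrableB _ If IE).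
have I5 := integrable_scale _ (n.+1%:R * (s' * q)) I4.
apply: (@le_trans _ _ (\int[mu]_t (n.+1%:R * (s' * q) * ((t - 0) ^+ 4 * normal_pdf 0 s' t)))).
  apply: le_Rintegral => //.
    apply: (@integrable_norm _ _ _ mu _ (fun t => f t - s * q * normal_pdf 0 s t)).
    by apply: eq_integrable (integrableB _ If IE).
  move=> t _; have := H t; rewrite !expR_normal// -/s -/s' => /le_trans; apply.
  by rewrite subr0 le_eqVlt; apply/orP; left; apply/eqP; ring.
rewrite RintegralZl//.
have H5 : `|gauss_avg s' (fun t => (t - 0) ^+ 4) 0| <= 64 * s' ^+ 4.
  apply: gauss_avg_bound => //; first exact: measurable_dev.
  by move=> u; rewrite normrX; exact: dev_le_quartic.
have -> : 64 * n.+1%:R * (Num.sqrt (n%:R * c / 9)) ^- 5 * q = n.+1%:R * (s' * q) * (64 * s' ^+ 4).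
  by rewrite -exprVn -/s'; ring.
have w0 : 0 <= n.+1%:R * (s' * q) by rewrite !mulr_ge0// ltW.
by apply: (ler_wpM2l w0); exact: le_trans (ler_norm _) H5.
Qed.

Lemma bern_sq_cvg (x : R) : 0 < x < 1 ->
  (fun m => Num.sqrt m%:R * \sum_(i < m) bern i (m - 1) x ^+ 2) @ \oo --> psi x.
Proof.
move=> /andP[x0 x1]; have [c cE] : exists c, c = 2 * x * (1 - x) by exists (2 * x * (1 - x)).
have c0 : 0 < c by rewrite cE !mulr_gt0// subr_gt0.
have c2 : c <= 2^-1 by rewrite cE; have := sqr_ge0 (x - 2^-1); rewrite expr2; lra.
have q0 := @sqrt2pi_gt0 R.
have q2 : q ^+ 2 = 2 * pi by rewrite sqr_sqrtr ?mulr_natl// mulrn_wge0// pi_ge0.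
pose sc := Num.sqrt c; have sc0 : 0 < sc by rewrite sqrtr_gt0.
have psiE : psi x = (sc * q)^-1.
  rewrite /psi /sc -sqrtrM ?ltW//; congr (Num.sqrt _)^-1.
  by rewrite cE -(mulr_natl pi 2); ring.
rewrite psiE.
(* [243 = 3^5] comes from the factor 9 under the fifth power of the square root; the two factors 2
   come from [(n + 2)^(1/2) <= 2 n^(1/2)] and [n + 1 <= 2 n]. *)
pose C := 64 * (2 * 2 * 243) / (sc ^+ 5 * q).
have bd n : (0 < n)%N -> `|Num.sqrt (n.+2)%:R * \sum_(i < n.+2) bern i n.+1 x ^+ 2 -
    Num.sqrt (1 + n.+1%:R^-1) * (sc * q)^-1| <= C * n%:R^-1.
  move=> n0.
  have c02 : 0 < c <= 2^-1 by rewrite c0.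
  have := laplace_bound c n n0 c02.
  rewrite {1}cE bern_parseval -q2.
  have N0 : 0 < n%:R :> R by rewrite ltr0n.
  rewrite !sqrtrM// ?mulr_ge0// ?(ltW c0)// -/sc.
  have s9 : Num.sqrt 9^-1 = 3^-1 :> R.
    by rewrite (_ : 9^-1 = 3^-1 ^+ 2 :> R) ?sqrtr_sqr ?ger0_norm//; field.
  rewrite s9.
  have M2 : 1 + n.+1%:R^-1 = n.+2%:R / n.+1%:R :> R by rewrite -(natr1 n.+1); field.
  rewrite M2 sqrtrM// sqrtrV//.
  have rn0 : 0 < Num.sqrt n%:R :> R by rewrite sqrtr_gt0.
  have rM0 : 0 < Num.sqrt n.+1%:R :> R by rewrite sqrtr_gt0.
  have rm0 : 0 < Num.sqrt n.+2%:R :> R by rewrite sqrtr_gt0.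
  have rm : Num.sqrt n.+2%:R <= 2 * Num.sqrt n%:R :> R.
    have : Num.sqrt n.+2%:R ^+ 2 <= (2 * Num.sqrt n%:R) ^+ 2 :> R.
      by rewrite exprMn !sqr_sqrtr// -natrX -natrM ler_nat; clear -n0; lia.
    by rewrite ler_pXn2r ?nnegrE ?mulr_ge0 ?sqrtr_ge0.
  have Mn : n.+1%:R <= 2 * Num.sqrt n%:R ^+ 2 :> R.
    by rewrite sqr_sqrtr// -natrM ler_nat; clear -n0; lia.
  have -> : n%:R^-1 = Num.sqrt n%:R ^- 2 :> R by rewrite sqr_sqrtr.
  move: (\sum_(i < _) _) => A.
  have M0 : 0 <= n.+1%:R :> R by [].
  move: rn0 rM0 rm0 rm Mn M0.
  move: (Num.sqrt n%:R) (Num.sqrt n.+1%:R) (Num.sqrt n.+2%:R) => rn rM rm.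
  move: n.+1%:R => M rn0 rM0 rm0 rmn Mn M0 H.
  have -> : rm * A - rm / rM * (sc * q)^-1 = rm / q ^+ 2 * (q ^+ 2 * A - (rM * sc)^-1 * q).
    by field; rewrite !gt_eqF.
  have w0 : 0 <= rm / q ^+ 2 by rewrite divr_ge0 ?sqr_ge0 ?(ltW rm0).
  rewrite normrM (ger0_norm w0).
  apply: le_trans (ler_wpM2l w0 H) _.
  have -> : rm / q ^+ 2 * (64 * M * (rn * sc / 3) ^- 5 * q) =
     rm * M * (64 * 243 / (rn ^+ 5 * sc ^+ 5 * q)) by field; rewrite !gt_eqF.
  have -> : C / rn ^+ 2 = (2 * rn) * (2 * rn ^+ 2) * (64 * 243 / (rn ^+ 5 * sc ^+ 5 * q)).
    by rewrite /C; field; rewrite !gt_eqF.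
  have w1 : 0 <= 64 * 243 / (rn ^+ 5 * sc ^+ 5 * q).
    by apply: ltW; rewrite divr_gt0// !mulr_gt0// exprn_gt0.
  apply: (ler_wpM2r w1); apply: ler_pM => //; exact: ltW.
(* With [m = k + 3] and [n = k + 1], the exponent [m - 1] equals [n + 1] and [bd] applies since
   [n > 0]. *)
rewrite -(cvg_shiftn 3).
have h1 : @harmonic R @ \oo --> (0 : R) := cvg_harmonic.
have h2 : (fun k => k.+2%:R^-1 : R) @ \oo --> (0 : R).
  by move: h1; rewrite -cvg_shiftS.
have g_cvg : (fun k => Num.sqrt (1 + k.+2%:R^-1) * (sc * q)^-1) @ \oo --> (sc * q)^-1.
  have h3 : (fun k => 1 + k.+2%:R^-1 : R) @ \oo --> (1 + 0 : R).
    by apply: cvgD => //; exact: cvg_cst.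
  have h4 := cvg_comp _ _ h3 (@sqrt_continuous R (1 + 0)).
  rewrite addr0 sqrtr1 in h4.
  by rewrite -[X in _ --> X]mul1r; apply: cvgM => //; exact: cvg_cst.
have C_cvg : (fun k => C * harmonic k) @ \oo --> (0 : R).
  by rewrite -(mulr0 C); apply: cvgM => //; exact: cvg_cst.
apply/cvgrPdist_le => e e0.
have e2 : 0 < e / 2 by rewrite divr_gt0.
near=> k.
apply: le_trans (ler_distD (Num.sqrt (1 + k.+2%:R^-1) * (sc * q)^-1) _ _) _.
rewrite (splitr e); apply: lerD.
  by near: k; move/cvgrPdist_le : g_cvg; apply.
rewrite /= ?addn3 ?add3n subn1 distrC; apply: le_trans (bd k.+1 isT) _.
apply: le_trans (ler_norm _) _; rewrite -normrN -sub0r.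
by near: k; move/cvgrPdist_le : C_cvg; apply.
Unshelve. all: by end_near. Qed.

End laplace.

(** * Limiting variance *)

Section variance.
Context {R : realType}.
Context (x G : R) (q : nat -> nat -> R).
Hypotheses (x01 : 0 <= x <= 1) (G0 : 0 <= G).
Hypothesis q0 : forall m k, 0 <= q m k.
Hypothesis q1 : forall m, \sum_(k < m) q m k <= 1.
(* [q m k] stands for the mass of the [k]-th of [m] cells, [G] for the density at [x]. *)
Hypothesis near_far : forall e : R, 0 < e -> exists2 C : R, 0 <= C &
  \forall m \near \oo, forall k, (k < m)%N ->
    `|m%:R * q m k - G| <= e \/ bern k (m - 1) x <= C / m%:R.

Local Notation p m k := (bern k (m - 1) x).

Lemma bern_sum1_pred m : (0 < m)%N -> \sum_(k < m) p m k = 1.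
Proof. by case: m => // m _; rewrite subn1 bern_sum1. Qed.

(** Near cells have mass at most [(G + 1) / m] and are charged to [p]; far cells have [m p <= C] and
    are charged to [q]. Both families have total at most 1. *)
Lemma mean_bounded : exists2 C, 0 <= C & \forall m \near \oo,
  0 <= \sum_(k < m) q m k * (m%:R * p m k) <= C.
Proof.
have [C C0 nf] := near_far 1 ltr01; exists (G + 1 + C); first by rewrite !addr_ge0.
near=> m; have m0 : (0 < m)%N by near: m; exact: nbhs_infty_gt.
have mR : 0 < m%:R :> R by rewrite ltr0n.
apply/andP; split.
  by apply: sumr_ge0 => k _; rewrite mulr_ge0// mulr_ge0// bern_ge0.
apply: (@le_trans _ _ (\sum_(k < m) ((G + 1) * p m k + C * q m k))).
  apply: ler_sum => k _.
  have p0 : 0 <= p m k by exact: bern_ge0.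
  have [near_k|far_k] : `|m%:R * q m k - G| <= 1 \/ p m k <= C / m%:R.
    by move: (nat_of_ord k) (ltn_ord k); near: m.
  - rewrite mulrA (mulrC (q m k)).
    have : m%:R * q m k <= G + 1 by move: near_k; rewrite ler_norml; lra.
    move=> /(ler_wpM2r p0) /le_trans; apply; by rewrite lerDl mulr_ge0.
  - rewrite (mulrC _ (m%:R * _)).
    have : m%:R * p m k <= C by rewrite mulrC -ler_pdivlMr.
    move=> /(ler_wpM2r (q0 m k)) /le_trans; apply; rewrite lerDr mulr_ge0// addr_ge0//.
rewrite big_split/= -!mulr_sumr bern_sum1_pred// mulr1 lerD2l.
by rewrite ler_piMr; [|exact: C0|exact: q1].
Unshelve. all: by end_near. Qed.

(** [b] is the part of the scaling that depends on [m]: [m^(-1/4)] with [W = psi x] in the interior,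
    [m^(-1/2)] with [W = 1] at the end points. One argument serves both regimes. *)
Context (b : nat -> R) (W : R).
Hypotheses (b0 : b @ \oo --> (0 : R)).
Hypothesis bW : (fun m => b m ^+ 2 * (m%:R * \sum_(k < m) p m k ^+ 2)) @ \oo --> W.

Let second_moment m := \sum_(k < m) q m k * (m%:R * p m k) ^+ 2.
Let mean m := \sum_(k < m) q m k * (m%:R * p m k).

Let b2_cvg (C : R) : (fun m => b m ^+ 2 * C) @ \oo --> (0 : R).
Proof.
have h := cvg_comp _ _ b0 (@exprn_continuous R 2 0); rewrite expr0n /= in h.
have : (fun m => b m ^+ 2 * C) @ \oo --> 0 * C by apply: cvgM => //; exact: cvg_cst.
by rewrite mul0r.
Qed.

Lemma mean_sq_cvg : (fun m => b m ^+ 2 * mean m ^+ 2) @ \oo --> (0 : R).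
Proof.
have [C C0 mC] := mean_bounded.
apply: (@squeeze_cvgr _ _ _ _ (cst 0) (fun m => b m ^+ 2 * C ^+ 2)).
- near=> m; rewrite mulr_ge0 ?sqr_ge0//= ler_wpM2l ?sqr_ge0//.
  have /andP[M0 MC] : 0 <= mean m <= C by near: m.
  by rewrite lerXn2r ?nnegrE.
- exact: cvg_cst.
- exact: b2_cvg.
Unshelve. all: by end_near. Qed.

Let W0 : 0 <= W.
Proof.
rewrite -(cvg_lim _ bW)//; apply: limr_ge; first by apply/cvg_ex; exists W.
near=> m; rewrite mulr_ge0 ?sqr_ge0// mulr_ge0// sumr_ge0// => k _; exact: sqr_ge0.
Unshelve. all: by end_near. Qed.

(** Replacing [m q] by [G] costs a small multiple of [m sum p^2] on near cells and at most
    [C^2 + C G] on far ones; the latter is bounded, so [b^2] removes it. *)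
Lemma second_moment_cvg : (fun m => b m ^+ 2 * second_moment m) @ \oo --> G * W.
Proof.
have GW : (fun m => G * (b m ^+ 2 * (m%:R * \sum_(k < m) p m k ^+ 2))) @ \oo --> G * W.
  by apply: cvgM => //; exact: cvg_cst.
apply/cvgrPdist_le => e e0.
(* Eventually [b^2 m sum p^2 <= W + 1], so the near cells cost at most [e / 3]. *)
pose e1 := e / 3 / (W + 1).
have W1 : 0 < W + 1 by rewrite ltr_wpDl.
have e10 : 0 < e1 by rewrite !divr_gt0.
have [C C0 nf] := near_far e1 e10.
have e3 : 0 < e / 3 by rewrite divr_gt0.
near=> m.
have m0 : (0 < m)%N by near: m; exact: nbhs_infty_gt.
have mR : 0 < m%:R :> R by rewrite ltr0n.
have H1 : `|G * W - G * (b m ^+ 2 * (m%:R * \sum_(k < m) p m k ^+ 2))| <= e / 3.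
  by near: m; move/cvgrPdist_le : GW; apply.
have H2 : b m ^+ 2 * (C ^+ 2 + C * G) <= e / 3.
  apply: le_trans (ler_norm _) _; rewrite -normrN -sub0r.
  by near: m; move/cvgrPdist_le : (b2_cvg (C ^+ 2 + C * G)); apply.
have H3 : b m ^+ 2 * (m%:R * \sum_(k < m) p m k ^+ 2) <= W + 1.
  have : `|W - b m ^+ 2 * (m%:R * \sum_(k < m) p m k ^+ 2)| <= 1.
    by near: m; move/cvgrPdist_le : bW; apply.
  by rewrite ler_norml; lra.
have H4 : `|m%:R * G * \sum_(k < m) p m k ^+ 2 - second_moment m| <=
    e1 * (m%:R * \sum_(k < m) p m k ^+ 2) + (C ^+ 2 + C * G).
  rewrite mulr_sumr -sumrB; apply: le_trans (ler_norm_sum _ _ _) _.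
  apply: (@le_trans _ _ (\sum_(k < m) (e1 * m%:R * p m k ^+ 2 + (C ^+ 2 * q m k + C * G * p m k)))).
    apply: ler_sum => k _.
    have p0 : 0 <= p m k by exact: bern_ge0.
    have -> : m%:R * G * p m k ^+ 2 - q m k * (m%:R * p m k) ^+ 2 =
       - ((m%:R * q m k - G) * (m%:R * p m k ^+ 2)) by ring.
    have w0 : 0 <= m%:R * p m k ^+ 2 by rewrite mulr_ge0 ?sqr_ge0.
    have cq : 0 <= C ^+ 2 * q m k := mulr_ge0 (sqr_ge0 C) (q0 m k).
    have cp : 0 <= C * G * p m k := mulr_ge0 (mulr_ge0 C0 G0) p0.
    have ep := mulr_ge0 (mulr_ge0 (ltW e10) (ler0n R m)) (sqr_ge0 (p m k)).
    rewrite normrN normrM (ger0_norm w0).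
    have [near_k|far_k] : `|m%:R * q m k - G| <= e1 \/ p m k <= C / m%:R.
      by move: (nat_of_ord k) (ltn_ord k); near: m.
    - apply: (@le_trans _ _ (e1 * (m%:R * p m k ^+ 2))); first exact: ler_wpM2r.
      by rewrite mulrA lerDl addr_ge0.
    - have mp : m%:R * p m k <= C by rewrite mulrC -ler_pdivlMr.
      apply: (@le_trans _ _ ((m%:R * q m k + G) * (m%:R * p m k ^+ 2))).
        apply: ler_wpM2r => //; apply: le_trans (ler_normB _ _) _.
        by rewrite !ger0_norm// mulr_ge0.
      rewrite mulrDl -[leLHS]add0r lerD//.
      apply: lerD.
        have -> : m%:R * q m k * (m%:R * p m k ^+ 2) = (m%:R * p m k) ^+ 2 * q m k by ring.
        by rewrite ler_wpM2r// lerXn2r ?nnegrE// (mulr_ge0 _ p0).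
      have -> : G * (m%:R * p m k ^+ 2) = (m%:R * p m k) * (G * p m k) by ring.
      by rewrite -(mulrA C) ler_wpM2r// (mulr_ge0 G0 p0).
  rewrite !big_split/= -!mulr_sumr bern_sum1_pred// mulr1 -mulrA lerD2l lerD2r.
  by rewrite ler_piMr; [|exact: sqr_ge0|exact: q1].
have -> : G * W - b m ^+ 2 * second_moment m =
  (G * W - G * (b m ^+ 2 * (m%:R * \sum_(k < m) p m k ^+ 2))) +
  b m ^+ 2 * (m%:R * G * \sum_(k < m) p m k ^+ 2 - second_moment m) by ring.
apply: le_trans (ler_normD _ _) _.
rewrite [X in _ + X]normrM (ger0_norm (sqr_ge0 _)).
have H5 := ler_wpM2l (sqr_ge0 (b m)) H4.
have H6 : e1 * (b m ^+ 2 * (m%:R * \sum_(k < m) p m k ^+ 2)) <= e / 3.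
  apply: le_trans (ler_wpM2l (ltW e10) H3) _.
  by rewrite /e1 divfK// gt_eqF.
move: H5; rewrite mulrDr mulrCA; move: H1 H2 H6; lra.
Unshelve. all: by end_near. Qed.

Lemma variance_cvg :
  (fun m => b m ^+ 2 * (second_moment m - mean m ^+ 2)) @ \oo --> G * W.
Proof.
rewrite -[X in _ --> X]subr0; under eq_fun do rewrite mulrBr.
by apply: cvgB; [exact: second_moment_cvg|exact: mean_sq_cvg].
Qed.

End variance.

(** * Cells and their masses *)

Lemma big_option (R : nmodType) (I : finType) (F : option I -> R) :
  \sum_o F o = F None + \sum_i F (Some i).
Proof.
rewrite (bigD1 None)//=; congr (_ + _).
rewrite (reindex_omap Some id); last by case.
by apply: eq_bigl => i; rewrite /= eqxx.
Qed.

Lemma fin_num_addeI (R : realDomainType) (a b c : \bar R) : a \is a fin_num ->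
  (a + b = a + c)%E -> b = c.
Proof. by move=> fa E; rewrite -(addeK b fa) (addeC b a) E (addeC a c) addeK. Qed.

Section cells.
Context {R : realType}.
Implicit Types (x y : R) (m k : nat).

(** Open on the left because [ecdf] counts with [<=]: its increments see exactly these intervals. *)
Definition binitv m k : interval R := `]k%:R / m%:R, k.+1%:R / m%:R].

(* [None] when [y] lies outside (0, 1]. *)
Definition cell m y : option 'I_m := [pick k : 'I_m | y \in binitv m k].

Definition weight m x (o : option 'I_m) : R :=
  if o is Some k then m%:R * bern k (m - 1) x else 0.

Lemma cellP m y (k : 'I_m) : (cell m y == Some k) = (y \in binitv m k).
Proof.
have m0 : 0 < m%:R :> R by rewrite ltr0n; case: m k => [[]|].
have le_ (i j : 'I_m) : y \in binitv m i -> y \in binitv m j -> (i <= j)%N.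
  rewrite !in_itv/= => /andP[iy _] /andP[_ yj].
  by have := lt_le_trans iy yj; rewrite ltr_pM2r ?invr_gt0// ltr_nat ltnS.
rewrite /cell; case: pickP => [i yi|none]; last by rewrite none.
apply/eqP/idP => [[<-]//|yk]; congr Some; apply/val_inj/eqP.
by rewrite eqn_leq !le_.
Qed.

Lemma cell_preim_Some m (k : 'I_m) : cell m @^-1` [set Some k] = [set` binitv m k].
Proof. by apply/seteqP; split => y /=; rewrite -cellP => /eqP. Qed.

Lemma cell_preim_None m :
  cell m @^-1` [set None] = ~` \bigcup_(k in [set` index_enum 'I_m]) [set` binitv m k].
Proof.
apply/seteqP; split => y /=.
  by move=> yN [k _] /=; rewrite -cellP yN.
move=> H; rewrite /cell; case: pickP => // k yk; case: H.
by exists k => //=; rewrite mem_index_enum.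
Qed.

Lemma measurable_cell m o : measurable (cell m @^-1` [set o]).
Proof.
case: o => [k|]; first by rewrite cell_preim_Some; exact: measurable_itv.
by rewrite cell_preim_None; apply: measurableC; apply: fin_bigcup_measurable.
Qed.

Lemma fhat_weight {d} {T : measurableType d} (Y : nat -> T -> R) m n x w :
  fhat Y m n x w = n%:R^-1 * \sum_(j < n) weight m x (cell m (Y j w)).
Proof.
have D y (k : 'I_m) : ((y <= k.+1%:R / m%:R)%R : bool)%:R - ((y <= k%:R / m%:R)%R : bool)%:R
    = (cell m y == Some k)%:R :> R.
  rewrite cellP /binitv in_itv/=.
  have m0 : 0 < m%:R :> R by rewrite ltr0n; case: m k => [[]|].
  have kk : k%:R / m%:R <= k.+1%:R / m%:R :> R by rewrite ler_pM2r ?invr_gt0// ler_nat.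
  have [yk|yk] := leP y (k%:R / m%:R); first by rewrite (le_trans yk kk) subrr.
  by rewrite /= subr0.
have Wt o : weight m x o = \sum_(k < m) (o == Some k)%:R * (m%:R * bern k (m - 1) x).
  case: o => [k0|] /=; last by rewrite big1// => k _; rewrite mul0r.
  rewrite (bigD1 k0)//= eqxx mul1r big1 ?addr0// => k kk0.
  rewrite (_ : (Some k0 == Some k) = false) ?mul0r//.
  by apply/negbTE/eqP => -[] E; rewrite E eqxx in kk0.
under eq_bigr do rewrite Wt.
rewrite /fhat /ecdf mulr_sumr exchange_big /= mulr_sumr; apply: eq_bigr => k _.
rewrite -mulrBr -sumrB (eq_bigr _ (fun (i : 'I_n) _ => D (Y i w) k)).
by rewrite -mulr_suml; ring.
Qed.

End cells.

Section law.
Context {d : measure_display} {T : measurableType d} {R : realType}.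
Context (P : probability T R) (Y : nat -> T -> R) (g : R -> R) (x : R).
Local Notation mu := (@lebesgue_measure R).
Hypotheses (mY : forall j, measurable_fun setT (Y j)) (mg : measurable_fun setT g)
  (g0 : forall y, 0 < g y).
Hypothesis cdf : forall j y, P (Y j @^-1` `]-oo, y]) =
               (\int[mu]_(u in `]-oo, y]) (g u)%:E)%E.

Let mpre j (A : set R) : measurable A -> measurable (Y j @^-1` A).
Proof. by move=> mA; rewrite -[X in measurable X]setTI; exact: mY. Qed.

Lemma prob_itv j a b : a <= b ->
  P (Y j @^-1` `]a, b]) = (\int[mu]_(u in `]a, b]) (g u)%:E)%E.
Proof.
move=> ab.
have U : `]-oo, b]%classic = `]-oo, a]%classic `|` `]a, b]%classic.
  by rewrite -itv_bndbnd_setU// bnd_simp.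
have dis : [disjoint `]-oo, a]%classic & `]a, b]%classic].
  apply/disj_setPS => u [] /=; rewrite !in_itv/= => ua /andP[]; by rewrite ltNge ua.
have := cdf j b; rewrite U preimage_setU measureU//; [|exact: mpre..|]; last first.
  rewrite -preimage_setI -[RHS](preimage_set0 (Y j)); congr (_ @^-1` _).
  by apply/eqP; rewrite -disj_set2E.
rewrite ge0_integral_setU//; last 2 first.
  by apply/measurable_EFinP; exact: measurable_funTS.
  by move=> u _; rewrite lee_fin ltW.
have fa : P (Y j @^-1` `]-oo, a]) \is a fin_num by rewrite fin_num_measure//; exact: mpre.
rewrite -(cdf j a) => E.
exact: (fin_num_addeI _ _ _ _ fa E).
Qed.

Definition mass m k : R := fine (\int[mu]_(u in [set` @binitv R m k]) (g u)%:E)%E.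

Lemma binitv_le m k : k%:R / m%:R <= k.+1%:R / m%:R :> R.
Proof. by rewrite ler_wpM2r ?invr_ge0// ler_nat. Qed.

Lemma prob_binitv j m k : P (Y j @^-1` [set` binitv m k]) = (mass m k)%:E.
Proof.
rewrite /mass -(prob_itv j)//; last exact: binitv_le.
by rewrite fineK// fin_num_measure//; apply: mpre; exact: measurable_itv.
Qed.

(** The estimators are not confined to [(0, 1]]; [None] receives the outside mass, so that the cell
    law has total mass 1. *)
Definition cell_mass m (o : option 'I_m) : R :=
  if o is Some k then mass m k else 1 - \sum_(k < m) mass m k.

Lemma prob_cell j m o : P (Y j @^-1` (cell m @^-1` [set o])) = (cell_mass m o)%:E.
Proof.
case: o => [k|] /=; first by rewrite cell_preim_Some prob_binitv.
rewrite cell_preim_None -preimage_setC probability_setC; last first.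
  by apply: mpre; apply: fin_bigcup_measurable => // k _; exact: measurable_itv.
rewrite preimage_bigcup measure_fin_bigcup//; last 2 first.
- move=> i k _ _ [w [/=]]; rewrite -!cellP => /eqP -> /eqP [].
  by [].
- by move=> k _; apply: mpre; exact: measurable_itv.
rewrite -fsbig_seq ?index_enum_uniq//= EFinB -sumEFin.
by congr (_ - _)%E; apply: eq_bigr => k _; rewrite prob_binitv.
Qed.

Lemma mass_ge0 m k : 0 <= mass m k.
Proof. by rewrite fine_ge0// integral_ge0// => u _; rewrite lee_fin ltW. Qed.

Lemma cell_mass_ge0 m o : 0 <= cell_mass m o.
Proof. by rewrite -lee_fin -(prob_cell 0). Qed.

Lemma cell_mass_sum1 m : \sum_o cell_mass m o = 1.
Proof. by rewrite big_option /= subrK. Qed.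

Lemma mass_sum_le1 m : \sum_(k < m) mass m k <= 1.
Proof. by have := cell_mass_ge0 m None; rewrite /= subr_ge0. Qed.

(** Cells are sorted by the distance from their left end to [x], with threshold [r / 2]. Below it,
    continuity at [x] controls the average of [g] over the cell; above it, [bern_far] with
    [e = r / 4] applies. *)
Lemma mass_near_far (cg : {for x, continuous g}) (x01 : 0 <= x <= 1) e : 0 < e ->
  exists2 C : R, 0 <= C & \forall m \near \oo, forall k, (k < m)%N ->
    `|m%:R * mass m k - g x| <= e \/ bern k (m - 1) x <= C / m%:R.
Proof.
move=> e0.
have /nbhs_ballP[/= r r0 rg] : \forall y \near x, `|g x - g y| <= e.
  by move/cvgrPdist_le : cg; apply.
exists ((r / 4) ^- 2); first by rewrite invr_ge0 sqr_ge0.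
near=> m => k km.
have m0 : (0 < m)%N by near: m; exact: nbhs_infty_gt.
have mR : 0 < m%:R :> R by rewrite ltr0n.
(* Used twice: a near cell is then shorter than the remaining margin, and for a far one the passage
   from [m x] to [(m - 1) x] moves the centre by at most [1 <= m r / 4]. *)
have mr : 4 / r <= m%:R.
  by near: m; exact: nbhs_infty_ger.
have [nr|far] := ltP (`|k%:R / m%:R - x|) (r / 2); [left|right].
  have H u : [set` binitv m k] u -> `|g u - g x| <= e.
    rewrite /binitv /= in_itv/= => /andP[ku uk]; rewrite distrC; apply: rg.
    rewrite /ball/=.
    have : k.+1%:R / m%:R <= k%:R / m%:R + r / 4.
      rewrite -natr1 mulrDl lerD2l mul1r -[leRHS]invf_div lef_pV2 ?posrE ?divr_gt0//.
    by move: nr; rewrite !ltr_norml; lra.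
  have Ig : mu.-integrable [set` binitv m k] (fun u => (g u)%:E).
    apply/integrableP; split; first by apply/measurable_EFinP; exact: measurable_funTS.
    under eq_integral do rewrite /= ger0_norm ?ltW//.
    rewrite -(prob_itv 0) ?binitv_le// (le_lt_trans (probability_le1 _ _)) ?ltry//.
    by apply: mpre; exact: measurable_itv.
  have Ic (c : R) : mu.-integrable [set` binitv m k] (fun u => c%:E).
    apply: (@integrableS _ _ _ mu `[k%:R / m%:R, k.+1%:R / m%:R]) => //.
      by apply: subset_itvr; rewrite bnd_simp.
    exact: continuous_itvcc_integrable (@cst_continuous _ _ c).
  have lenE : fine (mu [set` binitv m k]) = m%:R^-1.
    rewrite lebesgue_measure_itv/= lte_fin ltr_pM2r ?invr_gt0// ltr_nat ltnSn -EFinB/=.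
    by rewrite -mulrBl -natr1 addrAC subrr add0r mul1r.
  have -> : m%:R * mass m k - g x = m%:R * \int[mu]_(u in [set` binitv m k]) (g u - g x).
    rewrite (RintegralB _ Ig (Ic (g x)))// Rintegral_cst// lenE.
    by rewrite mulrBr; congr (_ - _); rewrite mulrCA divff ?mulr1// gt_eqF.
  rewrite normrM gtr0_norm// mulrC -ler_pdivlMr//.
  rewrite -lenE -Rintegral_cst; last exact: measurable_itv.
  apply: le_trans (le_normr_Rintegral _ _) _ => //.
    exact: eq_integrable (integrableB _ Ig (Ic _)).
  apply: le_Rintegral => //; last exact: Ic.
  apply: (@integrable_norm _ _ _ mu _ (fun u => g u - g x)).
  exact: eq_integrable (integrableB _ Ig (Ic _)).
have mE : m = (m - 1).+1 by rewrite subn1 prednK.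
have := bern_far k (m - 1) x (r / 4); rewrite -mE; apply => //; first by rewrite divr_gt0.
  by rewrite -ltnS -mE.
have mx : (m - 1)%:R * x = m%:R * x - x by rewrite natrB// mulrBl mul1r.
have -> : k%:R - (m - 1)%:R * x = m%:R * (k%:R / m%:R - x) + x.
  by rewrite mx; field; rewrite gt_eqF.
have H1 : m%:R * (r / 2) <= `|m%:R * (k%:R / m%:R - x)|.
  by rewrite normrM (gtr0_norm mR) ler_wpM2l// ltW.
have H2 : 1 <= m%:R * (r / 4).
  by move: mr; rewrite ler_pdivrMr// => mr4; rewrite mulrA ler_pdivlMr// mul1r.
have H3 := lerB_normD (m%:R * (k%:R / m%:R - x)) x.
have H4 : `|x| <= 1 by case/andP: x01 => ? ?; rewrite ger0_norm.
apply: le_trans H3; rewrite mulrC; move: H1 H2 H4; nra.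
Unshelve. all: by end_near. Qed.

End law.

(** * The limit theorem for the estimator under a general scaling *)

Section final.
Context {d : measure_display} {T : measurableType d} {R : realType}.
Context (P : probability T R) (Y : nat -> T -> R) (g : R -> R) (x : R).
Local Notation mu := (@lebesgue_measure R).
Hypotheses (mY : forall j, measurable_fun setT (Y j)) (iY : mutually_independent P Y)
  (mg : measurable_fun setT g) (g0 : forall y, 0 < g y).
Hypothesis cdf : forall j y, P (Y j @^-1` `]-oo, y]) =
               (\int[mu]_(u in `]-oo, y]) (g u)%:E)%E.
Hypotheses (cg : {for x, continuous g}) (x01 : 0 <= x <= 1).

Local Notation q m := (cell_mass g m).
Local Notation v m := (weight m x).

Let q0 m o : 0 <= q m o := cell_mass_ge0 P Y g mY mg g0 cdf m o.

Definition mean_weight m := \sum_o q m o * v m o.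

(** [fhat] is a finite combination of indicators of the events that a given observation falls into a
    given cell, so integrability is immediate and [n] drops out of the mean. *)
Lemma expectation_fhat m n : (0 < n)%N -> fine ('E_P[fhat Y m n x])%E = mean_weight m.
Proof.
move=> n0; rewrite unlock -/(Rintegral P setT (fhat Y m n x)).
pose A (p : 'I_n * option 'I_m) := Y p.1 @^-1` (cell m @^-1` [set p.2]).
have mA p : measurable (A p).
  by rewrite -[A p]setTI; apply: mY => //; exact: measurable_cell.
have IA p : P.-integrable setT (fun w => (\1_(A p) w)%:E) by exact: integrable_indic.
have IcA p (c : R) : P.-integrable setT (fun w => (c * \1_(A p) w)%:E).
  by apply: eq_integrable (integrableZl _ c (IA p)).
transitivity (\int[P]_w \sum_p n%:R^-1 * v m p.2 * \1_(A p) w).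
  apply: eq_Rintegral => w _; rewrite -[LHS]/(fhat Y m n x w) (fhat_weight Y m n x w).
  rewrite -(pair_bigA _ (fun j o => n%:R^-1 * v m o * \1_(A (j, o)) w)) mulr_sumr /=.
  apply: eq_bigr => j _; rewrite (bigD1 (cell m (Y j w)))//= big1 ?addr0.
    by rewrite indicE mem_set// mulr1.
  by move=> o oN; rewrite indicE memNset ?mulr0// /A /= => E; rewrite E eqxx in oN.
rewrite Rintegral_bigsum//.
rewrite (eq_bigr (fun p : 'I_n * option 'I_m => n%:R^-1 * v m p.2 * q m p.2)); last first.
  move=> p _; rewrite RintegralZl//; last exact: IA.
  congr (_ * _); rewrite /Rintegral integral_indic// setIT.
  exact: (congr1 fine (prob_cell P Y g mY mg g0 cdf p.1 m p.2)).
rewrite -(pair_bigA _ (fun j o => n%:R^-1 * v m o * q m o)) /= sumr_const card_ord.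
rewrite -[LHS]mulr_natl mulr_sumr; apply: eq_bigr => o _.
by rewrite !mulrA divff ?mul1r ?pnatr_eq0 -?lt0n// mulrC.
Qed.

Lemma mean_weightE m : mean_weight m = \sum_(k < m) mass g m k * (m%:R * bern k (m - 1) x).
Proof. by rewrite /mean_weight big_option /= mulr0 add0r. Qed.

Context (b : nat -> R) (W : R).
Hypotheses (b0 : forall m, 0 <= b m) (b_cvg : b @ \oo --> (0 : R)) (W0 : 0 < W).
Hypothesis bW : (fun m => b m ^+ 2 * (m%:R * \sum_(k < m) bern k (m - 1) x ^+ 2)) @ \oo --> W.
Context (ms ns : nat -> nat).
Hypotheses (moo : ms @ \oo --> \oo) (noo : ns @ \oo --> \oo).
Hypothesis mn : (fun k => (ms k)%:R / (ns k)%:R : R) @ \oo --> (0 : R).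

Let X k (o : option 'I_(ms k)) : R :=
  b (ms k) / Num.sqrt (ns k)%:R * (v (ms k) o - mean_weight (ms k)).

Let near_ns : \forall k \near \oo, (0 < ns k)%N.
Proof. exact: (noo _ (nbhs_infty_gt 0)). Qed.

Let centered k : \sum_o q (ms k) o * X k o = 0.
Proof.
rewrite /X; under eq_bigr do rewrite mulrCA mulrBr.
rewrite -mulr_sumr sumrB -mulr_suml (cell_mass_sum1 g) mul1r.
by rewrite /mean_weight subrr mulr0.
Qed.

Let scaled_var k : (0 < ns k)%N -> (ns k)%:R * \sum_o q (ms k) o * X k o ^+ 2 =
  b (ms k) ^+ 2 * ((\sum_(i < ms k) mass g (ms k) i * ((ms k)%:R * bern i (ms k - 1) x) ^+ 2)
   - (\sum_(i < ms k) mass g (ms k) i * ((ms k)%:R * bern i (ms k - 1) x)) ^+ 2).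
Proof.
move=> nk; set S2 := (X in _ * (X - _)).
have S2E : S2 = \sum_o q (ms k) o * v (ms k) o ^+ 2.
  by rewrite big_option /= expr0n mulr0 add0r.
rewrite -mean_weightE S2E.
have nn : 0 < (ns k)%:R :> R by rewrite ltr0n.
have nE : (ns k)%:R = Num.sqrt (ns k)%:R ^+ 2 :> R by rewrite sqr_sqrtr.
have [M ME] : exists M, mean_weight (ms k) = M by exists (mean_weight (ms k)).
rewrite ME.
transitivity ((ns k)%:R * (b (ms k) / Num.sqrt (ns k)%:R) ^+ 2 *
   (\sum_o q (ms k) o * v (ms k) o ^+ 2 - 2 * M * (\sum_o q (ms k) o * v (ms k) o)
     + M ^+ 2 * \sum_o q (ms k) o)).
  rewrite -[RHS]mulrA; congr (_ * _); rewrite !mulr_sumr -sumrB -big_split/= mulr_sumr.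
  by apply: eq_bigr => o _; rewrite /X ME; ring.
rewrite (cell_mass_sum1 g) -/(mean_weight _) ME mulr1.
rewrite expr_div_n -nE mulrCA divff ?mulr1 ?gt_eqF//.
by ring.
Qed.

Let var_cvg : (fun k => (ns k)%:R * \sum_o q (ms k) o * X k o ^+ 2) @ \oo -->
  Num.sqrt (g x * W) ^+ 2.
Proof.
rewrite sqr_sqrtr; last by rewrite mulr_ge0// ltW.
have := variance_cvg x (g x) (mass g) x01 (ltW (g0 x)) (mass_ge0 g g0)
  (mass_sum_le1 P Y g mY mg g0 cdf) (mass_near_far P Y g x mY mg g0 cdf cg x01) b W b_cvg bW.
move=> /(cvg_comp _ _ moo); apply: cvg_trans; apply: near_eq_cvg.
by near=> k; rewrite /= scaled_var//; near: k; exact: near_ns.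
Unshelve. all: by end_near. Qed.

(** A uniform bound on the scaled summands: both the weight and its mean lie between 0 and
    [m (sum p^2)^(1/2)]. The second factor tends to [W^(1/2)], the first to 0, and the third moments
    are at most [Xmax] times the variances. *)
Let Xmax k : R := Num.sqrt ((ms k)%:R / (ns k)%:R) *
  Num.sqrt (b (ms k) ^+ 2 * ((ms k)%:R * \sum_(i < ms k) bern i (ms k - 1) x ^+ 2)).

Let X_le k o : `|X k o| <= Xmax k.
Proof.
set S := \sum_(i < ms k) bern i (ms k - 1) x ^+ 2.
have S0 : 0 <= S by apply: sumr_ge0 => i _; exact: sqr_ge0.
have v0 o' : 0 <= v (ms k) o'.
  by case: o' => [i|]//=; rewrite mulr_ge0// bern_ge0.
have vle o' : v (ms k) o' <= (ms k)%:R * Num.sqrt S.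
  case: o' => [i|] /=; last by rewrite mulr_ge0// sqrtr_ge0.
  rewrite ler_wpM2l// -[leLHS]ger0_norm ?bern_ge0// -sqrtr_sqr ler_sqrt//.
  by rewrite /S (bigD1 i)//= lerDl sumr_ge0// => j _; exact: sqr_ge0.
have M0 : 0 <= mean_weight (ms k) by apply: sumr_ge0 => o' _; rewrite mulr_ge0.
have Mle : mean_weight (ms k) <= (ms k)%:R * Num.sqrt S.
  rewrite (avg_cst _ (q (ms k)) (cell_mass_sum1 g (ms k)) (_ * _)).
  by apply: ler_sum => o' _; apply: ler_wpM2l; [exact: q0|exact: vle].
have XmaxE : Xmax k = b (ms k) / Num.sqrt (ns k)%:R * ((ms k)%:R * Num.sqrt S).
  rewrite /Xmax -/S (sqrtrM (_^-1) (ler0n R (ms k))) (sqrtrM _ (sqr_ge0 _)).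
  rewrite (sqrtrM S (ler0n R (ms k))) sqrtr_sqr ger0_norm// sqrtrV//.
  have -> : (ms k)%:R * Num.sqrt S = Num.sqrt (ms k)%:R ^+ 2 * Num.sqrt S by rewrite sqr_sqrtr.
  by ring.
have w0 : 0 <= b (ms k) / Num.sqrt (ns k)%:R by rewrite divr_ge0 ?sqrtr_ge0.
rewrite XmaxE normrM (ger0_norm w0) ler_wpM2l//.
have := v0 o; have := vle o; move: M0 Mle; rewrite ler_norml.
by move=> *; apply/andP; split; lra.
Qed.

Let Xmax_cvg : Xmax @ \oo --> (0 : R).
Proof.
have h1 := cvg_comp _ _ mn (@sqrt_continuous R 0).
have h2 := cvg_comp _ _ (cvg_comp _ _ moo bW) (@sqrt_continuous R W).
have : Xmax @ \oo --> Num.sqrt 0 * Num.sqrt W by apply: cvgM; [exact: h1|exact: h2].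
by rewrite sqrtr0 mul0r.
Qed.

Let third_cvg : (fun k => (ns k)%:R * \sum_o q (ms k) o * `|X k o| ^+ 3) @ \oo --> (0 : R).
Proof.
apply: (@squeeze_cvgr _ _ _ _ (cst 0)
  (fun k => Xmax k * ((ns k)%:R * \sum_o q (ms k) o * X k o ^+ 2))).
- near=> k; apply/andP; split.
    by rewrite mulr_ge0// sumr_ge0// => o _; rewrite mulr_ge0// exprn_ge0.
  rewrite [leRHS]mulrCA ler_wpM2l// mulr_sumr; apply: ler_sum => o _.
  rewrite [leRHS]mulrCA ler_wpM2l// exprS -[X k o ^+ 2]real_normK ?num_real//.
  by rewrite ler_wpM2r ?sqr_ge0.
- exact: cvg_cst.
- have := cvgM Xmax_cvg var_cvg; rewrite mul0r; exact.
Unshelve. all: by end_near. Qed.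

Theorem fhat_clt t :
  (fun k => P [set w | Num.sqrt (ns k)%:R * b (ms k) *
     (fhat Y (ms k) (ns k) x w - fine ('E_P[fhat Y (ms k) (ns k) x])%E) <= t])
  @ \oo --> normal_prob 0 (Num.sqrt (g x * W)) `]-oo, t].
Proof.
have s0 : 0 < Num.sqrt (g x * W) by rewrite sqrtr_gt0 mulr_gt0.
have C := triangular_clt (Num.sqrt (g x * W)) ns (fun k => option 'I_(ms k))
  (fun k => q (ms k)) X s0 (fun k => q0 (ms k)) (fun k => cell_mass_sum1 g (ms k))
  centered noo var_cvg third_cvg t.
rewrite -[X in _ --> X]fineK ?fin_num_measure//.
have : (fun k => (iter (ns k) (avgshift (option 'I_(ms k)) (q (ms k)) (X k)) (le_ind t) 0)%:E)
    @ \oo --> (fine (normal_prob 0 (Num.sqrt (g x * W)) `]-oo, t]))%:E.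
  by apply: cvg_EFin; [exact: nearW|exact: C].
apply: cvg_trans; apply: near_eq_cvg; near=> k.
have nk : (0 < ns k)%N by near: k; exact: near_ns.
have nn : 0 < (ns k)%:R :> R by rewrite ltr0n.
rewrite -(iid_sum_law P Y mY iY _ (cell (ms k)) (q (ms k)) (X k) (measurable_cell (ms k))
   (fun j => prob_cell P Y g mY mg g0 cdf j (ms k))).
congr (P _); apply/seteqP.
suff E w : \sum_(j < ns k) X k (cell (ms k) (Y j w)) = Num.sqrt (ns k)%:R * b (ms k) *
     (fhat Y (ms k) (ns k) x w - fine ('E_P[fhat Y (ms k) (ns k) x])%E).
  by split => w /=; rewrite E.
rewrite expectation_fhat// fhat_weight /X -mulr_sumr sumrB sumr_const card_ord.
rewrite -[mean_weight _ *+ _]mulr_natl.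
have nE : (ns k)%:R = Num.sqrt (ns k)%:R ^+ 2 :> R by rewrite sqr_sqrtr.
have : 0 < Num.sqrt (ns k)%:R :> R by rewrite sqrtr_gt0.
move: nE; set rn := Num.sqrt _ => -> rn0.
by field; rewrite gt_eqF.
Unshelve. all: by end_near. Qed.

End final.

Theorem theorem1 (d : measure_display) (T : measurableType d) (R : realType)
    (P : probability T R) (Y : nat -> T -> R) (g : R -> R) (x : R) :
  (forall j, measurable_fun setT (Y j)) ->
  mutually_independent P Y ->
  measurable_fun setT g ->
  (forall y, 0 < g y) ->
  (forall j y, P (Y j @^-1` `]-oo, y]) =
               (\int[lebesgue_measure]_(u in `]-oo, y]) (g u)%:E)%E) ->
  {for x, continuous g} ->
  0 <= x <= 1 ->
  forall (ms ns : nat -> nat),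
    ms @ \oo --> \oo ->
    ns @ \oo --> \oo ->
    (fun k => (ms k)%:R / (ns k)%:R : R) @ \oo --> (0 : R) ->
    (0 < x < 1 ->
      forall t : R,
        (fun k => P [set w | (ns k)%:R `^ (2^-1) * (ms k)%:R `^ (- 4^-1) *
             (fhat Y (ms k) (ns k) x w - fine ('E_P[fhat Y (ms k) (ns k) x])%E)
             <= t])
        @ \oo --> normal_prob 0 (Num.sqrt (g x * psi x)) `]-oo, t])
    /\
    ((x = 0 \/ x = 1) ->
      forall t : R,
        (fun k => P [set w | (ns k)%:R `^ (2^-1) * (ms k)%:R `^ (- 2^-1) *
             (fhat Y (ms k) (ns k) x w - fine ('E_P[fhat Y (ms k) (ns k) x])%E)
             <= t])
        @ \oo --> normal_prob 0 (Num.sqrt (g x)) `]-oo, t]).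

Proof.
move=> mY iY mg g0 cdf cg x01 ms ns moo noo mn.
split=> [x01s t|xe t].
- have W0 : 0 < psi x.
    have /andP[x0 x1] := x01s.
    by rewrite /psi invr_gt0 sqrtr_gt0 !mulr_gt0 ?pi_gt0 ?subr_gt0.
  (* Nested square roots express [m^(-1/4)], so that [b^2 m] is [m^(1/2)], the factor in
     [bern_sq_cvg]. *)
  pose b m : R := Num.sqrt (Num.sqrt m%:R)^-1.
  have bE m : m%:R `^ (- 4^-1) = b m.
    rewrite powRN (_ : 4^-1 = 2^-1 * 2^-1); last by field.
    by rewrite powRrM !powR12_sqrt ?sqrtr_ge0// /b sqrtrV ?sqrtr_ge0.
  have b_cvg : b @ \oo --> (0 : R).
    by have := cvg_comp _ _ (@invsqrt_cvg0 R) (@sqrt_continuous R 0); rewrite sqrtr0.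
  have bW : (fun m => b m ^+ 2 * (m%:R * \sum_(k < m) bern k (m - 1) x ^+ 2)) @ \oo --> psi x.
    rewrite (_ : (fun m => _) = fun m => Num.sqrt m%:R * \sum_(k < m) bern k (m - 1) x ^+ 2).
      exact: bern_sq_cvg.
    apply/funext => m; rewrite /b sqr_sqrtr ?invr_ge0 ?sqrtr_ge0// mulrA; congr (_ * _).
    have [->|m0] := posnP m; first by rewrite mulr0 sqrtr0.
    rewrite -{2}(@sqr_sqrtr R m%:R)// expr2 mulKf// gt_eqF// sqrtr_gt0 ltr0n//.
  have := fhat_clt P Y g x mY iY mg g0 cdf cg x01 b (psi x) (fun m => sqrtr_ge0 _) b_cvg W0 bW
    ms ns moo noo mn t.
  by under eq_fun do rewrite -bE -powR12_sqrt//.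
- pose b m : R := (Num.sqrt m%:R)^-1.
  have bE m : m%:R `^ (- 2^-1) = b m by rewrite powRN powR12_sqrt.
  have b0 m : 0 <= b m by rewrite invr_ge0 sqrtr_ge0.
  have bW : (fun m => b m ^+ 2 * (m%:R * \sum_(k < m) bern k (m - 1) x ^+ 2)) @ \oo --> (1 : R).
    apply: (@cvg_trans _ (1 @[m --> \oo])); last exact: cvg_cst.
    apply: near_eq_cvg; near=> m.
    have m0 : (0 < m)%N by near: m; exact: nbhs_infty_gt.
    rewrite /b exprVn sqr_sqrtr// mulrA mulVf ?mul1r ?pnatr_eq0 -?lt0n//.
    rewrite -(prednK m0) subn1 /=; move: m.-1 => M.
    (* At an end point a single Bernstein polynomial is nonzero, with value 1: the first at 0, the
       last at 1. *)
    case: xe => ->.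
    - rewrite big_ord_recl /= big1 ?addr0.
        by rewrite /bern bin0 expr0 subr0 expr1n !mul1r expr1n.
      by move=> i _; rewrite /bern /bump leq0n add1n expr0n /= mulr0 mul0r expr0n.
    - rewrite big_ord_recr /= big1 ?add0r.
        by rewrite /bern binn subnn expr0 !expr1n !mulr1 expr1n.
      move=> i _; rewrite /bern subrr expr0n subn_eq0 leqNgt ltn_ord.
      by rewrite mulr0 expr0n.
  have := fhat_clt P Y g x mY iY mg g0 cdf cg x01 b 1 b0 (@invsqrt_cvg0 R) ltr01 bW
    ms ns moo noo mn t.
  rewrite mulr1.
  by under eq_fun do rewrite -bE -powR12_sqrt//.
Unshelve. all: by end_near. Qed.
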